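(* Let $(M,g)$ be an orientable, simply connected, complete three-dimensional Riemannian manifold with a unit Killing vector field $\xi$, and let $\pi:M\to B$ be a Killing submersion of $\xi$ with bundle curvature $\tau$. Assume $\tau>0$. Suppose that every short enough normal magnetic curve $c$ for the Killing magnetic field $F_\xi$ that generates a magnetic Hopf surface generates a magnetic Hopf surface $\pi^{-1}(\pi(c))$ of constant mean curvature. Then $M$ is a Sasakian manifold and $\xi$ is the Reeb vector field; that is, $M$ admits a Sasakian structure whose Reeb vector field is $\xi$.
   Context: Let $\nabla$ be the Levi-Civita connection of $g$ and let $\Omega$ be the Riemannian volume form for a fixed orientation of $M$. The vector product $\wedge$ is defined by $g(X\wedge Y,Z)=\Omega(X,Y,Z)$ for all vector fields $X,Y,Z$. Killing submersion: a Riemannian submersion $\pi:M\to B$ onto a (two-dimensional) Riemannian manifold $B$ whose fibers are the integral curves of the unit Killing vector field $\xi$. Bundle curvature: there is a function $\tau$ on $M$ with $\nabla_X\xi=\tau\,X\wedge\xi$ for all vector fields $X$; $\tau$ is constant along each fiber, hence it defines a function on $B$, called the bundle curvature of $\pi$. Killing magnetic field: the closed 2-form $F_\xi=\iota_\xi\Omega$. Its Lorentz force is $X\mapsto X\wedge\xi$. A normal magnetic curve for $F_\xi$ is a unit-speed curve $c:(a,b)\to M$ satisfying $\nabla_{\dot c}\dot c=\dot c\wedge\xi$. Along such a curve the angle $\theta_0\in[0,\pi]$ between $\dot c$ and $\xi$ is constant. ''Short enough'' means that $b-a$ is taken small enough (in particular so that, when $\dot c$ is not tangent to the fibers, $\pi^{-1}(\pi(c))$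 is an embedded surface). Magnetic Hopf surface: if $\dot c$ is not parallel to $\xi$, i.e. $\theta_0\neq 0,\pi$, the surface $\pi^{-1}(\pi(c((a,b))))\subset M$ is called the magnetic Hopf surface generated by $c$. Sasakian structure: an almost contact metric structure on an odd-dimensional manifold $M$ is a tuple $(\phi,\eta,\xi,g')$ of a $(1,1)$-tensor field $\phi$, a 1-form $\eta$, a vector field $\xi$ (the Reeb vector field) and a Riemannian metric $g'$ with $\phi^2=-I+\eta\otimes\xi$, $\eta(\xi)=1$, and $g'(\phi X,\phi Y)=g'(X,Y)-\eta(X)\eta(Y)$. It is a contact metric structure if $g'(X,\phi Y)=d\eta(X,Y)$ for all $X,Y$, with the convention $2\,d\eta(X,Y)=X\eta(Y)-Y\eta(X)-\eta([X,Y])$. It is Sasakian if moreover it is normal, i.e. the almost complex structure $J(X+f\partial_t)=\phi X-f\xi+\eta(X)\partial_t$ on $M\times\mathbb{R}$ is integrable; equivalently, an almost contact metric structure is Sasakian if and only if $(\nabla'_X\phi)Y=g'(X,Y)\xi-\eta(Y)X$, where $\nabla'$ is the Levi-Civita connection of $g'$. $M$ is a Sasakian manifold if it carries such a structure. *)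

(* Defs.v *)
From HB Require Import structures.
From mathcomp Require Import all_boot all_order all_algebra.
From mathcomp Require Import all_classical all_reals all_analysis.

Set Implicit Arguments.
Unset Strict Implicit.
Unset Printing Implicit Defensive.

Import Order.TTheory GRing.Theory Num.Theory.
Import numFieldNormedType.Exports.

Local Open Scope classical_set_scope.
Local Open Scope ring_scope.

Fixpoint Ck (R : realType) (n : nat) (V : normedModType R) (k : nat)
    (U : set 'rV[R]_n) (f : 'rV[R]_n -> V) : Prop :=
  if k is k'.+1 then
    forall x, U x -> differentiable f x /\ forall v, Ck k' U ('D_v f)
  else forall x, U x -> {for x, continuous f}.

Definition smooth_on (R : realType) (n : nat) (V : normedModType R)
    (U : set 'rV[R]_n) (f : 'rV[R]_n -> V) : Prop := forall k, Ck k U f.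

(* A smooth manifold given by an atlas.  The chart [i] is the homeomorphism
   [chart_map i] from the open set [chart_dom i] onto an open set of
   coordinates, with inverse [chart_inv i]; both are total functions whose
   values outside these sets are irrelevant. *)
Record manifold (R : realType) (n : nat) := Manifold {
  carrier :> topologicalType;
  chart : Type;
  chart_dom : chart -> set carrier;
  chart_map : chart -> carrier -> 'rV[R]_n;
  chart_inv : chart -> 'rV[R]_n -> carrier;
  carrier_hausdorff : hausdorff_space carrier;
  carrier_second_countable : @second_countable carrier;
  chart_dom_open : forall i, open (chart_dom i);
  chart_cover : forall p, exists i, chart_dom i p;
  chart_img_open : forall i, open (chart_map i @` chart_dom i);
  chart_mapK : forall i p, chart_dom i p -> chart_inv i (chart_map i p) = p;
  chart_map_continuous : forall i p, chart_dom i p ->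
    {for p, continuous (chart_map i)};
  chart_inv_continuous : forall i x, (chart_map i @` chart_dom i) x ->
    {for x, continuous (chart_inv i)};
  chart_transition_smooth : forall i j,
    smooth_on ((chart_map i @` chart_dom i) `&` (chart_inv i @^-1` chart_dom j))
      (chart_map j \o chart_inv i)
}.

Definition chart_img (R : realType) n (M : manifold R n) (i : chart M) :
  set 'rV[R]_n := chart_map i @` chart_dom i.

Definition chart_overlap (R : realType) n (M : manifold R n) (i j : chart M) :
  set 'rV[R]_n := chart_img i `&` (chart_inv i @^-1` chart_dom j).

Definition transition (R : realType) n (M : manifold R n) (i j : chart M) :
  'rV[R]_n -> 'rV[R]_n := chart_map j \o chart_inv i.

(* Vectors are rows: a tangent vector with components [v] in the chart [i] at
   [x] has components [v *m transition_jac i j x] in the chart [j]. *)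
Definition transition_jac (R : realType) n (M : manifold R n) (i j : chart M)
  (x : 'rV[R]_n) : 'M[R]_n := jacobian (transition i j) x.

(* A tensor field is the family of its components in the charts of the atlas,
   as functions of the coordinates (only the values on [chart_img i] matter),
   subject to smoothness and to the transformation law under change of charts.
   A vector has row components, a 1-form [eta] has column components and acts
   by [u *m eta], a (1,1)-tensor [phi] acts by [u *m phi], and a bilinear form
   [G] by [ip G u v]. *)

Definition ip (R : realType) n (G : 'M[R]_n) (u v : 'rV[R]_n) : R :=
  (u *m G *m v^T) 0 0.

Definition vector_field_on (R : realType) n (M : manifold R n) (O : set M)
    (X : chart M -> 'rV[R]_n -> 'rV[R]_n) : Prop :=
  (forall i, smooth_on (chart_img i `&` (chart_inv i @^-1` O)) (X i)) /\
  (forall i j x, chart_overlap i j x -> O (chart_inv i x) ->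
     X j (transition i j x) = X i x *m transition_jac i j x).

Definition vector_field (R : realType) n (M : manifold R n)
    (X : chart M -> 'rV[R]_n -> 'rV[R]_n) : Prop :=
  vector_field_on [set: M] X.

Definition one_form (R : realType) n (M : manifold R n)
    (eta : chart M -> 'rV[R]_n -> 'cV[R]_n) : Prop :=
  (forall i, smooth_on (chart_img i) (eta i)) /\
  (forall i j x, chart_overlap i j x ->
     eta i x = transition_jac i j x *m eta j (transition i j x)).

Definition tensor11 (R : realType) n (M : manifold R n)
    (phi : chart M -> 'rV[R]_n -> 'M[R]_n) : Prop :=
  (forall i, smooth_on (chart_img i) (phi i)) /\
  (forall i j x, chart_overlap i j x ->
     phi i x *m transition_jac i j x =
     transition_jac i j x *m phi j (transition i j x)).

Definition riemannian_metric (R : realType) n (M : manifold R n)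
    (g : chart M -> 'rV[R]_n -> 'M[R]_n) : Prop :=
  [/\ forall i, smooth_on (chart_img i) (g i),
      forall i j x, chart_overlap i j x ->
        g i x = transition_jac i j x *m g j (transition i j x)
                *m (transition_jac i j x)^T,
      forall i x, chart_img i x -> (g i x)^T = g i x
    & forall i x u, chart_img i x -> u != 0 -> 0 < ip (g i x) u u].

(* An orientation says which charts are positively oriented (value 1) and which
   are negatively oriented (value -1) at each point. *)
Definition orientation (R : realType) n (M : manifold R n)
    (o : chart M -> 'rV[R]_n -> R) : Prop :=
  [/\ forall i x, chart_img i x -> o i x = 1 \/ o i x = -1,
      forall i x, chart_img i x -> {for x, continuous (o i)}
    & forall i j x, chart_overlap i j x ->
        o i x = Num.sg (\det (transition_jac i j x)) * o j (transition i j x)].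

Definition lie_bracket (R : realType) n (X Y : 'rV[R]_n -> 'rV[R]_n)
    (x : 'rV[R]_n) : 'rV[R]_n := 'D_(X x) Y x - 'D_(Y x) X x.

(* With [G] the matrix of a metric in a chart, [christoffel G x u v] is
   nabla_U V at [x] for the constant coordinate fields U = u and V = v: the
   vector representing the right-hand side of Koszul's formula. *)
Definition christoffel (R : realType) n (G : 'rV[R]_n -> 'M[R]_n)
    (x u v : 'rV[R]_n) : 'rV[R]_n :=
  (\row_k (2^-1 * ('D_u (fun y => ip (G y) v (delta_mx 0 k)) x
                   + 'D_v (fun y => ip (G y) u (delta_mx 0 k)) x
                   - 'D_(delta_mx 0 k) (fun y => ip (G y) u v) x)))
  *m invmx (G x).

(* Levi-Civita covariant derivative of the field [Y] in the direction [u] *)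
Definition nabla (R : realType) n (G : 'rV[R]_n -> 'M[R]_n)
    (x u : 'rV[R]_n) (Y : 'rV[R]_n -> 'rV[R]_n) : 'rV[R]_n :=
  'D_u Y x + christoffel G x u (Y x).

Definition volume_form (R : realType) (o : R) (G : 'M[R]_3)
    (u v w : 'rV[R]_3) : R :=
  o * Num.sqrt (\det G) * \det (\matrix_(k < 3) nth 0 [:: u; v; w] k).

(* the vector representing the linear form [volume_form o G u v] *)
Definition cross (R : realType) (o : R) (G : 'M[R]_3) (u v : 'rV[R]_3) :
    'rV[R]_3 :=
  (\row_k volume_form o G u v (delta_mx 0 k)) *m invmx G.

Definition smooth_curve (R : realType) n (M : manifold R n) (J : set R)
    (c : R -> M) : Prop :=
  forall t, J t -> {for t, continuous c} /\
    forall (i : chart M) k, chart_dom i (c t) ->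
      derivable (derive1n k (chart_map i \o c)) t 1.

Definition velocity (R : realType) n (M : manifold R n) (i : chart M)
    (c : R -> M) (t : R) : 'rV[R]_n := derive1 (chart_map i \o c) t.

(* components in the chart [i] of the covariant derivative of the velocity *)
Definition acceleration (R : realType) n (M : manifold R n)
    (g : chart M -> 'rV[R]_n -> 'M[R]_n) (i : chart M)
    (c : R -> M) (t : R) : 'rV[R]_n :=
  derive1n 2 (chart_map i \o c) t
  + christoffel (g i) (chart_map i (c t)) (velocity i c t) (velocity i c t).

Definition integral_curve (R : realType) n (M : manifold R n)
    (X : chart M -> 'rV[R]_n -> 'rV[R]_n) (J : set R) (c : R -> M) : Prop :=
  smooth_curve J c /\
  forall t i, J t -> chart_dom i (c t) ->
    velocity i c t = X i (chart_map i (c t)).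

Definition geodesically_complete (R : realType) n (M : manifold R n)
    (g : chart M -> 'rV[R]_n -> 'M[R]_n) : Prop :=
  forall i p v, chart_dom i p -> exists c : R -> M,
    [/\ smooth_curve [set: R] c, c 0 = p, velocity i c 0 = v
      & forall t j, chart_dom j (c t) -> acceleration g j c t = 0].

Definition simply_connected (R : realType) (T : topologicalType) : Prop :=
  (forall p q : T, exists gamma : R -> T,
     [/\ {within `[0, 1], continuous gamma}, gamma 0 = p & gamma 1 = q]) /\
  (forall gamma : R -> T,
     {within `[0, 1], continuous gamma} -> gamma 0 = gamma 1 ->
     exists H : R * R -> T,
       [/\ {within `[0, 1] `*` `[0, 1], continuous H},
           {in `[0, 1], forall t, H (0, t) = gamma t},
           {in `[0, 1], forall t, H (1, t) = gamma 0}
         & {in `[0, 1], forall s, H (s, 0) = gamma 0 /\ H (s, 1) = gamma 0}]).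

(* The Lie derivative of the metric along [xi] vanishes. *)
Definition killing (R : realType) n (M : manifold R n)
    (g : chart M -> 'rV[R]_n -> 'M[R]_n)
    (xi : chart M -> 'rV[R]_n -> 'rV[R]_n) : Prop :=
  vector_field xi /\
  forall (i : chart M) (X Y : 'rV[R]_n -> 'rV[R]_n),
    smooth_on (chart_img i) X -> smooth_on (chart_img i) Y ->
    forall x, chart_img i x ->
      'D_(xi i x) (fun y => ip (g i y) (X y) (Y y)) x =
      ip (g i x) (lie_bracket (xi i) X x) (Y x)
      + ip (g i x) (X x) (lie_bracket (xi i) Y x).

Definition unit_field (R : realType) n (M : manifold R n)
    (g : chart M -> 'rV[R]_n -> 'M[R]_n)
    (xi : chart M -> 'rV[R]_n -> 'rV[R]_n) : Prop :=
  forall i x, chart_img i x -> ip (g i x) (xi i x) (xi i x) = 1.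

Definition smooth_map (R : realType) m n (M : manifold R m) (N : manifold R n)
    (f : M -> N) : Prop :=
  continuous f /\
  forall (i : chart M) (j : chart N),
    smooth_on (chart_img i `&` ((f \o chart_inv i) @^-1` chart_dom j))
      (chart_map j \o f \o chart_inv i).

(* differential of [f] in the charts [i] and [j], acting on rows *)
Definition differential (R : realType) m n (M : manifold R m)
    (N : manifold R n) (f : M -> N) (i : chart M) (j : chart N)
    (x : 'rV[R]_m) : 'M[R]_(m, n) :=
  jacobian (chart_map j \o f \o chart_inv i) x.

Definition riemannian_submersion (R : realType) m n (M : manifold R m)
    (N : manifold R n) (g : chart M -> 'rV[R]_m -> 'M[R]_m)
    (h : chart N -> 'rV[R]_n -> 'M[R]_n) (f : M -> N) : Prop :=
  [/\ smooth_map f,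
      forall b, exists p, f p = b,
      forall i j x, chart_img i x -> chart_dom j (f (chart_inv i x)) ->
        row_full (differential f i j x)
    & forall i j x, chart_img i x -> chart_dom j (f (chart_inv i x)) ->
        let A := differential f i j x in
        let horizontal u := forall w, w *m A = 0 -> ip (g i x) u w = 0 in
        forall u v, horizontal u -> horizontal v ->
          ip (h j (chart_map j (f (chart_inv i x)))) (u *m A) (v *m A)
          = ip (g i x) u v].

(* The fibres are the orbits of [xi]: the fibre of a point consists of the
   points that an integral curve of [xi] joins to it. *)
Definition killing_submersion (R : realType) (M : manifold R 3)
    (B : manifold R 2) (g : chart M -> 'rV[R]_3 -> 'M[R]_3)
    (xi : chart M -> 'rV[R]_3 -> 'rV[R]_3)
    (h : chart B -> 'rV[R]_2 -> 'M[R]_2) (proj : M -> B) : Prop :=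
  riemannian_submersion g h proj /\
  forall p q : M, proj p = proj q <->
    exists (a b s t : R) (c : R -> M),
      [/\ integral_curve xi `]a, b[ c, a < s < b, a < t < b, c s = p
        & c t = q].

(* The bundle curvature, which is constant along the fibres, is given as a
   function on the base. *)
Definition bundle_curvature (R : realType) (M : manifold R 3)
    (B : manifold R 2) (g : chart M -> 'rV[R]_3 -> 'M[R]_3)
    (o : chart M -> 'rV[R]_3 -> R)
    (xi : chart M -> 'rV[R]_3 -> 'rV[R]_3) (proj : M -> B)
    (tau : B -> R) : Prop :=
  forall i x u, chart_img i x ->
    nabla (g i) x u (xi i) =
    tau (proj (chart_inv i x)) *: cross (o i x) (g i x) u (xi i x).

Definition normal_magnetic_curve (R : realType) (M : manifold R 3)
    (g : chart M -> 'rV[R]_3 -> 'M[R]_3) (o : chart M -> 'rV[R]_3 -> R)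
    (xi : chart M -> 'rV[R]_3 -> 'rV[R]_3) (a b : R) (c : R -> M) : Prop :=
  [/\ a < b, smooth_curve `]a, b[ c,
      forall t i, a < t < b -> chart_dom i (c t) ->
        ip (g i (chart_map i (c t))) (velocity i c t) (velocity i c t) = 1
    & forall t i, a < t < b -> chart_dom i (c t) ->
        let x := chart_map i (c t) in
        acceleration g i c t = cross (o i x) (g i x) (velocity i c t) (xi i x)].

Definition has_angle (R : realType) (M : manifold R 3)
    (g : chart M -> 'rV[R]_3 -> 'M[R]_3)
    (xi : chart M -> 'rV[R]_3 -> 'rV[R]_3) (a b : R) (c : R -> M)
    (theta : R) : Prop :=
  forall t i, a < t < b -> chart_dom i (c t) ->
    let x := chart_map i (c t) in
    ip (g i x) (velocity i c t) (xi i x) = cos theta.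

Definition hopf_surface (R : realType) (M : manifold R 3) (B : manifold R 2)
    (proj : M -> B) (a b : R) (c : R -> M) : set M :=
  proj @^-1` (proj @` (c @` `]a, b[)).

(* Every point has a neighbourhood in [S] parametrized by a smooth immersion of
   an open set of the plane that is a homeomorphism onto its image. *)
Definition embedded_surface (R : realType) (M : manifold R 3) (S : set M) :
    Prop :=
  forall p, S p -> exists (O : set M) (U : set 'rV[R]_2) (f : 'rV[R]_2 -> M),
    [/\ open O, O p, open U & f @` U = S `&` O] /\
    [/\ forall y, U y -> {for y, continuous f},
        forall j : chart M,
          smooth_on (U `&` (f @^-1` chart_dom j)) (chart_map j \o f),
        forall (j : chart M) y, U y -> chart_dom j (f y) ->
          row_free (jacobian (chart_map j \o f) y),
        set_inj U f
      & forall W : set 'rV[R]_2, open W -> W `<=` U ->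
          exists2 O' : set M, open O' & f @` W = S `&` O'].

(* [v] is, in the chart [i], the velocity at [p] of a smooth curve in [S]. *)
Definition tangent_to (R : realType) (M : manifold R 3) (S : set M)
    (i : chart M) (p : M) (v : 'rV[R]_3) : Prop :=
  exists (e : R) (c : R -> M),
    [/\ 0 < e, smooth_curve `]- e, e[ c, forall t, - e < t < e -> S (c t),
        c 0 = p & velocity i c 0 = v].

(* [N] is a unit normal field along [S], extended smoothly to a neighbourhood;
   the mean curvature is half the trace of the shape operator
   v |-> - nabla_v N on the tangent planes. *)
Definition constant_mean_curvature (R : realType) (M : manifold R 3)
    (g : chart M -> 'rV[R]_3 -> 'M[R]_3) (S : set M) : Prop :=
  exists (O : set M) (N : chart M -> 'rV[R]_3 -> 'rV[R]_3) (H : R),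
    [/\ open O, S `<=` O, vector_field_on O N
      & forall i p, chart_dom i p -> S p ->
        let x := chart_map i p in
        [/\ ip (g i x) (N i x) (N i x) = 1,
            forall v, tangent_to S i p v -> ip (g i x) v (N i x) = 0
          & forall e1 e2, tangent_to S i p e1 -> tangent_to S i p e2 ->
              ip (g i x) e1 e1 = 1 -> ip (g i x) e2 e2 = 1 ->
              ip (g i x) e1 e2 = 0 ->
              2^-1 * (ip (g i x) (- nabla (g i) x e1 (N i)) e1
                      + ip (g i x) (- nabla (g i) x e2 (N i)) e2) = H]].

(* For every normal magnetic curve making a constant angle different from 0 and
   pi with [xi], each parameter has a neighbourhood all of whose subintervals
   generate, as soon as the generated surface is embedded, a surface of
   constant mean curvature. *)
Definition short_magnetic_hopf_surfaces_cmc (R : realType)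
    (M : manifold R 3) (B : manifold R 2)
    (g : chart M -> 'rV[R]_3 -> 'M[R]_3) (o : chart M -> 'rV[R]_3 -> R)
    (xi : chart M -> 'rV[R]_3 -> 'rV[R]_3) (proj : M -> B) : Prop :=
  forall (a b theta : R) (c : R -> M),
    normal_magnetic_curve g o xi a b c ->
    0 < theta < pi -> has_angle g xi a b c theta ->
    forall t0, a < t0 < b -> exists2 e : R, 0 < e &
      forall a' b', a <= a' -> t0 - e <= a' -> a' < b' -> b' <= b ->
        b' <= t0 + e ->
        embedded_surface (hopf_surface proj a' b' c) ->
        constant_mean_curvature g (hopf_surface proj a' b' c).

Definition almost_contact_metric (R : realType) n (M : manifold R n)
    (phi : chart M -> 'rV[R]_n -> 'M[R]_n)
    (eta : chart M -> 'rV[R]_n -> 'cV[R]_n)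
    (xi : chart M -> 'rV[R]_n -> 'rV[R]_n)
    (g : chart M -> 'rV[R]_n -> 'M[R]_n) : Prop :=
  [/\ tensor11 phi, one_form eta, vector_field xi & riemannian_metric g] /\
  [/\ forall i x (u : 'rV[R]_n), chart_img i x ->
        u *m phi i x *m phi i x = - u + u *m eta i x *m xi i x,
      forall i x, chart_img i x -> (xi i x *m eta i x) 0 0 = 1
    & forall i x u v, chart_img i x ->
        ip (g i x) (u *m phi i x) (v *m phi i x) =
        ip (g i x) u v - (u *m eta i x) 0 0 * (v *m eta i x) 0 0].

(* exterior derivative of a 1-form, with the convention
   2 d eta(X, Y) = X eta(Y) - Y eta(X) - eta([X, Y]) *)
Definition ext_derivative (R : realType) n (eta : 'rV[R]_n -> 'cV[R]_n)
    (X Y : 'rV[R]_n -> 'rV[R]_n) (x : 'rV[R]_n) : R :=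
  2^-1 * ('D_(X x) (fun y => (Y y *m eta y) 0 0) x
          - 'D_(Y x) (fun y => (X y *m eta y) 0 0) x
          - (lie_bracket X Y x *m eta x) 0 0).

Definition contact_metric (R : realType) n (M : manifold R n)
    (phi : chart M -> 'rV[R]_n -> 'M[R]_n)
    (eta : chart M -> 'rV[R]_n -> 'cV[R]_n)
    (xi : chart M -> 'rV[R]_n -> 'rV[R]_n)
    (g : chart M -> 'rV[R]_n -> 'M[R]_n) : Prop :=
  almost_contact_metric phi eta xi g /\
  forall (i : chart M) (X Y : 'rV[R]_n -> 'rV[R]_n),
    smooth_on (chart_img i) X -> smooth_on (chart_img i) Y ->
    forall x, chart_img i x ->
      ip (g i x) (X x) (Y x *m phi i x) = ext_derivative (eta i) X Y x.

(* The almost complex structure J(X + f d/dt) = phi X - f xi + eta(X) d/dt on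
   M x R, in the product of a chart of M and the line; the last component of a
   row is the one along d/dt. *)
Definition product_acs (R : realType) n (phi : 'rV[R]_n -> 'M[R]_n)
    (eta : 'rV[R]_n -> 'cV[R]_n) (xi : 'rV[R]_n -> 'rV[R]_n)
    (z w : 'rV[R]_(n + 1)) : 'rV[R]_(n + 1) :=
  let x := lsubmx z in
  row_mx (lsubmx w *m phi x - (rsubmx w) 0 0 *: xi x) (lsubmx w *m eta x).

(* Integrability of an almost complex structure on an open set of coordinates:
   the Nijenhuis torsion
   [JX, JY] - J [JX, Y] - J [X, JY] + J (J [X, Y]) vanishes. *)
Definition integrable_acs (R : realType) m (U : set 'rV[R]_m)
    (J : 'rV[R]_m -> 'rV[R]_m -> 'rV[R]_m) : Prop :=
  forall X Y : 'rV[R]_m -> 'rV[R]_m, smooth_on U X -> smooth_on U Y ->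
    forall z, U z ->
      let JX y := J y (X y) in
      let JY y := J y (Y y) in
      lie_bracket JX JY z - J z (lie_bracket JX Y z)
      - J z (lie_bracket X JY z) + J z (J z (lie_bracket X Y z)) = 0.

Definition sasakian_structure (R : realType) n (M : manifold R n)
    (phi : chart M -> 'rV[R]_n -> 'M[R]_n)
    (eta : chart M -> 'rV[R]_n -> 'cV[R]_n)
    (xi : chart M -> 'rV[R]_n -> 'rV[R]_n)
    (g : chart M -> 'rV[R]_n -> 'M[R]_n) : Prop :=
  contact_metric phi eta xi g /\
  forall i : chart M,
    integrable_acs [set z : 'rV[R]_(n + 1) | chart_img i (lsubmx z)]
      (product_acs (phi i) (eta i) (xi i)).

(* Main.v *)
(** Let eta = g(xi, .) and phi X = xi /\ X.  Since nabla_X xi = tau X /\ xi, the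
    form d eta is tau g(., phi .), so (phi, eta, xi) is contact metric for the
    metric g' equal to tau g on the planes orthogonal to xi, with xi unit and
    orthogonal to them: g' = tau g + (1 - tau) eta^2.  The vector product is
    parallel for g, hence
      (nabla_X phi) Y = nabla_X xi /\ Y = tau (g(X, Y) xi - eta(Y) X).
    With this formula the almost complex structure J on M x R satisfies
    nabla_{JX} J = (nabla_X J) J, and as nabla is torsion-free this makes the
    Nijenhuis torsion of J vanish, whether or not tau is constant. *)

Require Import Defs.
From HB Require Import structures.
From mathcomp Require Import all_boot all_order all_algebra.
From mathcomp Require Import all_classical all_reals all_analysis.
From mathcomp Require Import ring lra.
Import Order.TTheory GRing.Theory Num.Theory.
Import numFieldNormedType.Exports.
Local Open Scope classical_set_scope.
Local Open Scope ring_scope.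

Set Implicit Arguments.
Unset Strict Implicit.
Unset Printing Implicit Defensive.

(** * Vector products in coordinates *)

Local Notation i0 := (@Ordinal 3 0 isT).
Local Notation i1 := (@Ordinal 3 1 isT).
Local Notation i2 := (@Ordinal 3 2 isT).

(** Only the connection of g is ever computed. Integrability of J refers to no metric, so any
    torsion-free connection can test it, and that of g is the one for which the vector product is
    parallel; g' enters through its values alone. J does not contain tau, and nabla J has it as a
    common factor, so no derivative of tau occurs. In a chart vectors are rows and endomorphisms
    multiply on the right. With G the matrix of g and s = o sqrt(det G), phi is s crossmx(xi) G^-1.
    That the vector product is parallel then rests on two facts about the connection matrix Gam, D_u
    G = Gam G + G Gam^T and D_u s = s tr Gam, joined by the identity [crossmx_trace]. The inverse of
    G is never differentiated: s^2 = det G yields a second formula phi = s^-1 G crossmx(eta^T),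
    which gives smoothness, and the derivative of phi is extracted from phi G = s crossmx(xi). *)

Lemma ord3P (P : 'I_3 -> Prop) : P i0 -> P i1 -> P i2 -> forall i, P i.
Proof.
by move=> P0 P1 P2 [[|[|[|//]]] lti]; rewrite (bool_irrelevance lti isT).
Qed.

Lemma sum3E (V : nmodType) (F : 'I_3 -> V) :
  \sum_i F i = F i0 + F i1 + F i2.
Proof.
rewrite !big_ord_recl big_ord0 addr0 addrA.
by do !congr (_ + _); congr F; apply: val_inj.
Qed.

Section CrossMatrix.
Variable R : comNzRingType.
Implicit Types (a b : 'rV[R]_3) (P : 'M[R]_3).

Lemma det3E P : \det P =
  P i0 i0 * (P i1 i1 * P i2 i2 - P i1 i2 * P i2 i1)
  - P i0 i1 * (P i1 i0 * P i2 i2 - P i1 i2 * P i2 i0)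
  + P i0 i2 * (P i1 i0 * P i2 i1 - P i1 i1 * P i2 i0).
Proof.
pose Q (m n : nat) := P (inord m) (inord n).
have -> : P = \matrix_(i, j) Q i j.
  by apply/matrixP => i j; rewrite mxE /Q !inord_val.
rewrite (expand_det_row _ i0) sum3E /cofactor !(expand_det_row _ ord0).
rewrite !big_ord_recl !big_ord0 /cofactor !det_mx11 !mxE /= /bump /=.
by rewrite !add0n ?addn0 ?addn1 /=; ring.
Qed.

(* [b *m crossmx a] is the Euclidean vector product of [a] and [b]. *)
Definition crossmx a : 'M[R]_3 :=
  \matrix_(i, j) \det (\matrix_(k < 3) nth 0 [:: a; delta_mx 0 i; delta_mx 0 j] k).

Lemma crossmxE a i j : crossmx a i j =
  (nth [::] [:: [:: 0; a 0 i2; - a 0 i1]; [:: - a 0 i2; 0; a 0 i0];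
                [:: a 0 i1; - a 0 i0; 0]] i)`_j.
Proof.
rewrite !mxE det3E !mxE /=.
move: i j; apply: ord3P; apply: ord3P; rewrite ?mxE /=; ring.
Qed.

Lemma row_det_crossmx a b :
  (\row_k \det (\matrix_(i < 3) nth 0 [:: a; b; delta_mx 0 k] i))
  = b *m crossmx a.
Proof.
apply/rowP => k; rewrite !mxE sum3E !crossmxE det3E !mxE /=.
by move: k; apply: ord3P; rewrite ?mxE /=; ring.
Qed.

(** The vector triple product (a x b) x v = (a.v) b - (b.v) a, as matrices acting on v. *)
Lemma crossmx_mul a b : crossmx (b *m crossmx a) = a^T *m b - b^T *m a.
Proof.
apply/matrixP; apply: ord3P; apply: ord3P;
rewrite crossmxE !mxE !big_ord1 !mxE /= ?sum3E ?crossmxE /=; ring.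
Qed.

(** The other bracketing, b x (a x v) = (b.v) a - (a.b) v. *)
Lemma mul_crossmx a b : crossmx a *m crossmx b = b^T *m a - (a *m b^T) 0 0 *: 1%:M.
Proof.
apply/matrixP; apply: ord3P; apply: ord3P;
rewrite !mxE !big_ord1 !sum3E !crossmxE !mxE /=; ring.
Qed.

Lemma mul_crossmx_id a : a *m crossmx a = 0.
Proof.
apply/rowP; apply: ord3P; rewrite !mxE sum3E !crossmxE /=; ring.
Qed.

Lemma tr_crossmx a : (crossmx a)^T = - crossmx a.
Proof.
apply/matrixP; apply: ord3P; apply: ord3P;
rewrite mxE [in RHS]mxE !crossmxE /=; ring.
Qed.

Lemma crossmxD a b : crossmx (a + b) = crossmx a + crossmx b.
Proof.
apply/matrixP; apply: ord3P; apply: ord3P;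
rewrite [in RHS]mxE !crossmxE ?mxE /=; ring.
Qed.

Lemma crossmxZ (c : R) a : crossmx (c *: a) = c *: crossmx a.
Proof.
apply/matrixP; apply: ord3P; apply: ord3P;
rewrite [in RHS]mxE !crossmxE ?mxE /=; ring.
Qed.

Lemma crossmxB a b : crossmx (a - b) = crossmx a - crossmx b.
Proof. by rewrite crossmxD -scaleN1r crossmxZ scaleN1r. Qed.

(** Multiplicativity of the determinant: the (i, j) entry on the left is the determinant of the rows
    a P, e_i P, e_j P. *)
Lemma crossmx_congr a P : P *m crossmx (a *m P) *m P^T = \det P *: crossmx a.
Proof.
apply/matrixP; apply: ord3P; apply: ord3P;
rewrite [in RHS]mxE mxE sum3E ![(_ *m _) _ _]mxE !sum3E !crossmxE det3E;
rewrite ?mxE ?sum3E /=; ring.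
Qed.

(** The derivative of [crossmx_congr] at the identity in the direction [P]. *)
Lemma crossmx_trace a P :
  \tr P *: crossmx a
  = crossmx (a *m P) + P *m crossmx a + crossmx a *m P^T.
Proof.
apply/matrixP; apply: ord3P; apply: ord3P;
rewrite ![(_ + _ : 'M[R]_3) _ _]mxE ![(_ *: _ : 'M[R]_3) _ _]mxE;
rewrite ![(_ *m _) _ _]mxE /mxtrace !sum3E !crossmxE ?mxE ?sum3E /=; ring.
Qed.

End CrossMatrix.

(** Half of Sylvester's criterion; it makes the volume density sqrt(det G) smooth and nonzero. *)
Lemma posdef3_det_gt0 (R : realFieldType) (G : 'M[R]_3) : G^T = G ->
  (forall u : 'rV_3, u != 0 -> 0 < (u *m G *m u^T) 0 0) -> 0 < \det G.
Proof.
move=> Gsym Gpos.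
have Gs i j : G i j = G j i by rewrite -[in LHS]Gsym mxE.
have quad u : (u *m G *m u^T) 0 0 = \sum_i \sum_j u 0 i * G i j * u 0 j.
  rewrite mxE exchange_big /=; apply: eq_bigr => j _.
  by rewrite !mxE mulr_suml.
have row3 (p q r : R) : exists u : 'rV_3, [/\ u 0 i0 = p, u 0 i1 = q & u 0 i2 = r].
  by exists (\row_i nth 0 [:: p; q; r] i); rewrite !mxE.
have nz (u : 'rV[R]_3) k : u 0 k != 0 -> u != 0.
  by apply: contraNneq => ->; rewrite mxE.
(* On the last rows of cofactors of the leading blocks of order 1, 2 and 3, the
   form takes the products of two consecutive leading minors. *)
have [u [u0 u1 u2]] := row3 1 0 0.
have := Gpos u (nz u i0 _); rewrite quad !sum3E u0 u1 u2 oner_eq0 => /(_ isT) h1.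
have {}h1 : 0 < G i0 i0 by lra.
have [v [v0 v1 v2]] := row3 (- G i0 i1) (G i0 i0) 0.
have := Gpos v (nz v i1 _); rewrite quad !sum3E v0 v1 v2 gt_eqF// => /(_ isT) h2.
have {}h2 : 0 < G i0 i0 * G i1 i1 - G i0 i1 ^+ 2.
  rewrite -(pmulr_rgt0 _ h1); apply: lt_le_trans h2 _.
  by rewrite le_eqVlt (Gs i1 i0); apply/orP; left; apply/eqP; ring.
have [w [w0 w1 w2]] := row3 (G i0 i1 * G i1 i2 - G i0 i2 * G i1 i1)
  (G i0 i2 * G i0 i1 - G i0 i0 * G i1 i2) (G i0 i0 * G i1 i1 - G i0 i1 ^+ 2).
have := Gpos w (nz w i2 _); rewrite quad !sum3E w0 w1 w2 gt_eqF// => /(_ isT) h3.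
rewrite -(pmulr_rgt0 _ h2); apply: lt_le_trans h3 _.
rewrite det3E le_eqVlt (Gs i1 i0) (Gs i2 i0) (Gs i2 i1).
by apply/orP; left; apply/eqP; ring.
Qed.

Lemma mul_crossmxC (R : comNzRingType) (a b : 'rV[R]_3) :
  b *m crossmx a = - (a *m crossmx b).
Proof.
apply/rowP; apply: ord3P; rewrite [in RHS]mxE !mxE !sum3E !crossmxE /=; ring.
Qed.

(** * The endomorphism v |-> xi /\ v at a point *)

Section CrossEndo.
Variables (F : fieldType) (G : 'M[F]_3) (s : F) (xi : 'rV[F]_3).

(* When [s] is the density of the volume form, [v *m cross_endo] is the vector
   product of [xi] and [v] for the metric [G]. *)
Definition cross_endo := s *: (crossmx xi *m invmx G).
Definition metric_dual := G *m xi^T.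

Hypothesis s2 : s ^+ 2 = \det G.
Hypothesis s0 : s != 0.
Hypothesis Gsym : G^T = G.
Hypothesis xi1 : xi *m G *m xi^T = 1%:M.

Let Gunit : G \in unitmx.
Proof. by rewrite unitmxE -s2 unitfE expf_neq0. Qed.

Let metric_dual_tr : metric_dual^T = xi *m G.
Proof. by rewrite trmx_mul trmxK Gsym. Qed.

Lemma cross_endo_metric : cross_endo *m G = s *: crossmx xi.
Proof. by rewrite -scalemxAl mulmxKV. Qed.

(** [crossmx_congr] with P = G turns xi into its dual covector at the cost of det G = s^2. The new
    formula is free of the inverse of [G]. *)
Lemma cross_endoE : cross_endo = s^-1 *: (G *m crossmx metric_dual^T).
Proof.
apply: (can_inj (mulmxK Gunit)).
rewrite cross_endo_metric metric_dual_tr -scalemxAl -[X in _ *m X]Gsym.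
by rewrite crossmx_congr -s2 scalerA expr2 mulKf.
Qed.

(** With one factor in each of its two forms, s, G and their inverses cancel, and the Euclidean
    identity [mul_crossmx] remains. *)
Lemma cross_endo_sq : cross_endo *m cross_endo = metric_dual *m xi - 1%:M.
Proof.
rewrite {2}cross_endoE -scalemxAl -scalemxAr scalerA mulfV// scale1r.
rewrite mulmxA mulmxKV// mul_crossmx trmxK; congr (_ - _).
by rewrite mulmxA xi1 mxE eqxx scale1r.
Qed.

Lemma mul_xi_cross_endo : xi *m cross_endo = 0.
Proof. by rewrite -scalemxAr mulmxA mul_crossmx_id mul0mx scaler0. Qed.

Lemma mul_cross_endo_dual : cross_endo *m metric_dual = 0.
Proof.
rewrite mulmxA cross_endo_metric -scalemxAl; apply/trmx_inj.
by rewrite linearZ /= trmx_mul trmxK tr_crossmx mulmxN mul_crossmx_id oppr0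
  scaler0 trmx0.
Qed.

Lemma mul_xi_dual : xi *m metric_dual = 1%:M.
Proof. by rewrite mulmxA. Qed.

Lemma cross_endo_skew : G *m cross_endo^T = - (cross_endo *m G).
Proof.
rewrite -{1}Gsym -trmx_mul cross_endo_metric linearZ /=.
by rewrite tr_crossmx scalerN.
Qed.

(** The triple product for the metric [G]: (xi /\ w) /\ v = g(xi, v) w - g(w, v) xi. It evaluates
    (nabla_w xi) /\ v, since nabla_w xi is a multiple of xi /\ w. *)
Lemma crossmx_cross_endo w :
  s *: crossmx (w *m cross_endo) *m invmx G
  = metric_dual *m w - G *m w^T *m xi.
Proof.
rewrite cross_endoE -scalemxAr crossmxZ scalerA mulfV// scale1r mulmxA.
rewrite crossmx_mul mulmxBl trmxK metric_dual_tr trmx_mul Gsym.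
by rewrite -!mulmxA mulmxV// !mulmx1 mulmxA.
Qed.

(** The matrix of [product_acs] at a point. *)
Definition acs_mx : 'M[F]_(3 + 1) := block_mx cross_endo metric_dual (- xi) 0.

(* [tau *: nabla_acs w] is the covariant derivative of [acs_mx] along [w] when
   [nabla_u xi = - tau *: (u *m cross_endo)]. *)
Definition nabla_acs (w : 'rV[F]_(3 + 1)) : 'M[F]_(3 + 1) :=
  block_mx (G *m (lsubmx w)^T *m xi - metric_dual *m lsubmx w)
           (cross_endo *m G *m (lsubmx w)^T) (lsubmx w *m cross_endo) 0.

(** Block by block this follows from the relations between phi, eta and xi alone: the skewness of
    phi gives the upper left block, the skewness and the value of phi^2 the upper right one, and xi
    phi = 0 and phi eta = 0 the lower two. *)
Lemma nabla_acs_mul w : nabla_acs (w *m acs_mx) = nabla_acs w *m acs_mx.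
Proof.
rewrite /nabla_acs /acs_mx -[w]hsubmxK; move: (lsubmx w) (rsubmx w) => a b.
have := mul_xi_cross_endo; have := mul_cross_endo_dual; have := mul_xi_dual.
have := cross_endo_skew; have := cross_endo_sq.
have := erefl metric_dual; rewrite {1}/metric_dual.
move: cross_endo metric_dual => phi eta etaE sq skew xieta phieta xiphi.
rewrite mulmx_block mul_row_block !row_mxKl [b]mx11_scalar.
rewrite !mul0mx !mulmx0 !addr0 !mulmxN mul_scalar_mx.
set c := b 0 0; rewrite [(_ - _)^T]linearB /= trmx_mul [(c *: xi)^T]linearZ /=.
congr block_mx.
- rewrite ?(mulmxDl, mulmxDr, mulNmx, mulmxN) -?scalemxAl -?scalemxAr.
  rewrite etaE -scalemxAl [G *m (_ *m _)]mulmxA skew.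
  rewrite -[_ *m xi *m phi]mulmxA xiphi mulmx0 sub0r !mulmxA !mulNmx.
  move: (c *: _) (_ *m a *m phi) (_ *m xi) => A1 A2 A3.
  by apply/matrixP => i j; rewrite !mxE; ring.
- have ae : xi *m G *m a^T = a *m eta.
    have tr1 (A : 'M[F]_1) : A^T = A by rewrite [A]mx11_scalar tr_scalar_mx.
    by rewrite -etaE -[RHS]tr1 !trmx_mul trmxK Gsym.
  rewrite mulmxBr -scalemxAr -[phi *m G *m xi^T]mulmxA etaE phieta scaler0 subr0.
  rewrite -(mulmxA phi G) (mulmxA G) skew mulNmx mulmxN !mulmxA sq.
  rewrite !mulmxBl mul1mx opprB -!mulmxA xieta mulmx1; congr (_ - _).
  by rewrite -ae -!mulmxA.
- by rewrite mulmxBl -scalemxAl xiphi scaler0 subr0.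
- by rewrite -mulmxA phieta mulmx0.
Qed.

End CrossEndo.

(** The factor det J by which the density changes is the one that [crossmx_congr] produces, so the
    vector product is independent of the chart. *)
Lemma cross_endo_change (F : fieldType) (G G' J : 'M[F]_3) s' xi :
  G \in unitmx -> G = J *m G' *m J^T ->
  cross_endo G (\det J * s') xi *m J = J *m cross_endo G' s' (xi *m J).
Proof.
move=> Gu GE; have JG : G' *m J^T \in unitmx.
  by move: Gu; rewrite GE -mulmxA unitmx_mul => /andP[].
have G'u : G' \in unitmx by move: JG; rewrite unitmx_mul => /andP[].
apply: (can_inj (mulmxK JG)).
rewrite -[in LHS]mulmxA [J *m (_ *m _)]mulmxA -GE -scalemxAl mulmxKV//.
rewrite -scalemxAr -scalemxAl !mulmxA mulmxKV// crossmx_congr.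
by rewrite scalerA mulrC.
Qed.

(** * Calculus of matrix-valued and smooth functions *)

Section MatrixCalculus.
Context {R : realType} {V : normedModType R}.

Lemma differentiable_mxP m n (F : V -> 'M[R]_(m, n)) x :
  differentiable F x <-> forall i j, differentiable (fun y => F y i j) x.
Proof.
split=> [dF i j|dF].
  exact: (differentiable_comp dF (differentiable_coord (F x) i j)).
have -> : F = \sum_i \sum_j (fun y => F y i j *: delta_mx i j).
  apply/funext => y; rewrite fct_sumE [LHS]matrix_sum_delta.
  by apply: eq_bigr => i _; rewrite fct_sumE.
apply: differentiable_sum => i; apply: differentiable_sum => j.
exact: differentiableZl.
Qed.

Lemma derive_coord m n (F : V -> 'M[R]_(m, n)) x v i j :
  differentiable F x -> 'D_v F x i j = 'D_v (fun y => F y i j) x.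
Proof. by move=> dF; rewrite derive_mx ?mxE//; exact: diff_derivable. Qed.

Lemma differentiable_mulmx m n p (F : V -> 'M[R]_(m, n))
    (G : V -> 'M[R]_(n, p)) x :
  differentiable F x -> differentiable G x ->
  differentiable (fun y => F y *m G y) x.
Proof.
move=> /differentiable_mxP dF /differentiable_mxP dG.
apply/differentiable_mxP => i j.
have -> : (fun y => (F y *m G y) i j)
    = \sum_k ((fun y => F y i k) * (fun y => G y k j)).
  by apply/funext => y; rewrite mxE fct_sumE.
by apply: differentiable_sum => k; apply: differentiableM.
Qed.

Lemma derive_mulmx m n p (F : V -> 'M[R]_(m, n)) (G : V -> 'M[R]_(n, p)) x v :
  differentiable F x -> differentiable G x ->
  'D_v (fun y => F y *m G y) x = 'D_v F x *m G x + F x *m 'D_v G x.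
Proof.
move=> dF dG; apply/matrixP => i j.
rewrite derive_coord; last exact: differentiable_mulmx.
have -> : (fun y => (F y *m G y) i j)
    = \sum_k ((fun y => F y i k) * (fun y => G y k j)).
  by apply/funext => y; rewrite mxE fct_sumE.
move: (dF) (dG) => /differentiable_mxP cF /differentiable_mxP cG.
rewrite derive_sum => [|k]; last by apply: derivableM; exact: diff_derivable.
rewrite !mxE -big_split /=; apply: eq_bigr => k _.
rewrite deriveM; [|exact: diff_derivable..].
by rewrite !derive_coord// addrC; congr (_ + _); rewrite mulrC.
Qed.

Lemma differentiable_trmx m n (F : V -> 'M[R]_(m, n)) x :
  differentiable F x -> differentiable (fun y => (F y)^T) x.
Proof.
move=> /differentiable_mxP dF; apply/differentiable_mxP => i j.
by under eq_fun do rewrite mxE.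
Qed.

Lemma derive_trmx m n (F : V -> 'M[R]_(m, n)) x v :
  differentiable F x -> 'D_v (fun y => (F y)^T) x = ('D_v F x)^T.
Proof.
move=> dF; apply/matrixP => i j.
rewrite derive_coord ?mxE; last exact: differentiable_trmx.
by under eq_fun do rewrite mxE; rewrite derive_coord.
Qed.

Lemma differentiable_scalemx m n (f : V -> R) (F : V -> 'M[R]_(m, n)) x :
  differentiable f x -> differentiable F x ->
  differentiable (fun y => f y *: F y) x.
Proof.
move=> df /differentiable_mxP dF; apply/differentiable_mxP => i j.
have -> : (fun y => (f y *: F y) i j) = f * (fun y => F y i j).
  by apply/funext => y; rewrite mxE.
exact: differentiableM.
Qed.

Lemma derive_scalemx m n (f : V -> R) (F : V -> 'M[R]_(m, n)) x v :
  differentiable f x -> differentiable F x ->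
  'D_v (fun y => f y *: F y) x = 'D_v f x *: F x + f x *: 'D_v F x.
Proof.
move=> df dF; apply/matrixP => i j.
rewrite derive_coord ?mxE; last exact: differentiable_scalemx.
have -> : (fun y => (f y *: F y) i j) = f * (fun y => F y i j).
  by apply/funext => y; rewrite mxE.
move: (dF) => /differentiable_mxP cF.
rewrite deriveM; [|exact: diff_derivable..].
by rewrite derive_coord// addrC /GRing.scale /= [F x i j * _]mulrC.
Qed.

Lemma derive_dirP (W : normedModType R) (F : V -> W) x c u v :
  differentiable F x -> 'D_(c *: u + v) F x = c *: 'D_u F x + 'D_v F x.
Proof. by move=> dF; rewrite !deriveE// linearP. Qed.

End MatrixCalculus.

(** Both functions have the same first-order expansion at x, and uniqueness of the differential
    identifies ['d g x] with the continuous map ['d f x]. *)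
Lemma near_eq_differentiable (R : realType) (V W : normedModType R)
    (f g : V -> W) x :
  (\near x, f x = g x) -> differentiable f x -> differentiable g x.
Proof.
move=> fg df; have fgx : f x = g x := nbhs_singleton fg.
have expand : g \o shift x = cst (g x) + 'd f x +o_ 0 id.
  have /eqaddoP fo := diff_locally df.
  apply: (proj2 (eqaddoP _ _ _ _)) => e e0.
  move: fg; rewrite (near_shift 0 x) subr0 => fg.
  by apply: filterS2 fg (fo e e0) => h /= fgh; rewrite !fctE /= -fgx -fgh.
have cf : continuous ('d f x) by exact: diff_continuous.
by apply/diff_locallyP; rewrite (diff_unique cf expand).
Qed.

(** * Closure properties of smooth functions on an open set *)

Section Smooth.
Context {R : realType} {n : nat}.
Implicit Types (U : set 'rV[R]_n) (k : nat).

(** The functions are total but the rules of differentiation hold on [U] only, so each induction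
    below replaces a derivative by a formula valid on [U]. *)
Lemma eq_Ck (V : normedModType R) k U (f g : 'rV[R]_n -> V) : open U ->
  (forall x, U x -> f x = g x) -> Ck k U f -> Ck k U g.
Proof.
move=> Uo.
have near_fg (f' g' : 'rV[R]_n -> V) x : (forall y, U y -> f' y = g' y) ->
    U x -> \near x, f' x = g' x.
  by move=> fg Ux; apply: filterS fg _; exact: open_nbhs_nbhs.
elim: k f g => [|k IH] f g fg.
  move=> fc x Ux; have := fc x Ux; rewrite /prop_for /continuous_at -(fg x Ux).
  apply: cvg_trans; apply: near_eq_cvg; first exact: nbhs_filter.
  exact: (near_fg _ _ _ fg Ux).
move=> fd x Ux; have [df dkf] := fd x Ux; split=> [|v].
  exact: near_eq_differentiable (near_fg _ _ _ fg Ux) df.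
by apply: IH (dkf v) => y Uy; apply: near_eq_derive; exact: near_fg Uy.
Qed.

Lemma CkS (V : normedModType R) k U (f : 'rV[R]_n -> V) :
  Ck k.+1 U f -> Ck k U f.
Proof.
elim: k f => [|k IH] f fS x Ux.
  by apply: differentiable_continuous; case: (fS x Ux).
by have [df dkf] := fS x Ux; split=> [|v]; last exact: IH (dkf v).
Qed.

Lemma Ck_cst (V : normedModType R) k U (c : V) : open U ->
  Ck k U (fun _ : 'rV[R]_n => c).
Proof.
move=> Uo; elim: k c => [|k IH] c x Ux; first exact: cst_continuous.
split=> [|v]; first exact: differentiable_cst.
by apply: (eq_Ck Uo) (IH 0) => y _; rewrite derive_cst.
Qed.

Lemma CkD (V : normedModType R) k U (f g : 'rV[R]_n -> V) : open U ->
  Ck k U f -> Ck k U g -> Ck k U (fun x => f x + g x).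
Proof.
move=> Uo; elim: k f g => [|k IH] f g fk gk x Ux.
  by apply: continuousD; [exact: fk | exact: gk].
have [df dkf] := fk x Ux; have [dg dkg] := gk x Ux.
split=> [|v]; first exact: differentiableD.
apply: (eq_Ck Uo) (IH _ _ (dkf v) (dkg v)) => y Uy.
by rewrite deriveD//; apply: diff_derivable; [case: (fk y Uy) | case: (gk y Uy)].
Qed.

Lemma CkM k U (f g : 'rV[R]_n -> R) : open U ->
  Ck k U f -> Ck k U g -> Ck k U (fun x => f x * g x).
Proof.
move=> Uo; elim: k f g => [|k IH] f g fk gk x Ux.
  by apply: continuousM; [exact: fk | exact: gk].
have [df dkf] := fk x Ux; have [dg dkg] := gk x Ux.
split=> [|v]; first exact: differentiableM.
have := CkD Uo (IH _ _ (CkS fk) (dkg v)) (IH _ _ (CkS gk) (dkf v)).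
apply: (eq_Ck Uo) => y Uy.
by rewrite deriveM//; apply: diff_derivable; [case: (fk y Uy) | case: (gk y Uy)].
Qed.

Lemma CkN k U (f : 'rV[R]_n -> R) : open U ->
  Ck k U f -> Ck k U (fun x => - f x).
Proof.
move=> Uo fk; apply: (eq_Ck Uo) (CkM Uo (Ck_cst k (-1 : R) Uo) fk) => x _.
by rewrite mulN1r.
Qed.

Lemma CkV k U (f : 'rV[R]_n -> R) : open U -> (forall x, U x -> f x != 0) ->
  Ck k U f -> Ck k U (fun x => (f x)^-1).
Proof.
move=> Uo f0; elim: k => [|k IH] fk x Ux.
  by apply: continuousV; [exact: f0 | exact: fk].
have [df dkf] := fk x Ux.
split=> [|v]; first by apply: differentiableV => //; exact: f0.
(* The derivative -f'/f^2 involves 1/f itself, which the induction hypothesis covers at the lower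
   order. *)
have fVk := IH (CkS fk).
have := CkM Uo (Ck_cst k (-1 : R) Uo) (CkM Uo (CkM Uo fVk fVk) (dkf v)).
apply: (eq_Ck Uo) => y Uy.
rewrite deriveV ?f0//; last by apply: diff_derivable; case: (fk y Uy).
by rewrite /GRing.scale /= mulN1r expr2 invfM mulNr.
Qed.

Lemma Ck_sqrt k U (f : 'rV[R]_n -> R) : open U -> (forall x, U x -> 0 < f x) ->
  Ck k U f -> Ck k U (fun x => Num.sqrt (f x)).
Proof.
move=> Uo f0; elim: k => [|k IH] fk x Ux.
  apply: continuous_comp; [exact: fk | exact: sqrt_continuous].
have sqrt0 y : U y -> 2 * Num.sqrt (f y) != 0.
  by move=> Uy; rewrite mulf_neq0// ?pnatr_eq0// gt_eqF// sqrtr_gt0 f0.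
have dsqrt y : U y -> differentiable (@Num.sqrt R) (f y).
  move=> Uy; apply/derivable1_diffP.
  by have [] := is_derive1_sqrt (f0 y Uy).
have [df dkf] := fk x Ux.
split=> [|v]; first by apply: differentiable_comp => //; exact: dsqrt.
have := CkM Uo (CkV Uo sqrt0 (CkM Uo (Ck_cst k (2 : R) Uo) (IH (CkS fk)))) (dkf v).
apply: (eq_Ck Uo) => y Uy; have [dfy _] := fk y Uy.
rewrite [RHS]deriveE; last exact: differentiable_comp (dsqrt _ Uy).
rewrite diff_comp//=; last exact: dsqrt.
rewrite -(deriveE v dfy); set h := 'D_v f y.
have -> : 'd (@Num.sqrt R) (f y) h = h *: 'd (@Num.sqrt R) (f y) (1 : R).
  by rewrite -linearZZ /GRing.scale /= mulr1.
rewrite -deriveE; last exact: dsqrt.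
by rewrite derive_sqrt ?f0// mulrC.
Qed.

Lemma Ck_mxP p q k U (F : 'rV[R]_n -> 'M[R]_(p, q)) : open U ->
  Ck k U F <-> forall i j, Ck k U (fun x => F x i j).
Proof.
move=> Uo; elim: k F => [|k IH] F.
  split=> [Fc i j x Ux|Fc x Ux].
    apply: (@continuous_comp _ _ _ F (fun N : 'M[R]_(p, q) => N i j)).
      exact: Fc.
    exact: coord_continuous.
  move=> A [P Pnbhs PA].
  (* A neighbourhood of a matrix contains a product of neighbourhoods of its finitely many
     entries. *)
  suff: \forall y \near x, forall i j, P i j (F y i j).
    by apply: filterS => y; exact: PA.
  apply: (@filter_forall _ _ _ _ (nbhs_filter x)) => i.
  apply: (@filter_forall _ _ _ _ (nbhs_filter x)) => j.
  exact: Fc (Pnbhs i j).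
split=> [Fk i j x Ux|Fk x Ux].
  have [dF dkF] := Fk x Ux; split=> [|v].
    by move/differentiable_mxP: dF; exact.
  have /IH/(_ i j) := dkF v; apply: (eq_Ck Uo) => y Uy.
  by rewrite derive_coord//; case: (Fk y Uy).
have dF y : U y -> differentiable F y.
  by move=> Uy; apply/differentiable_mxP => i j; case: (Fk i j y Uy).
split=> [|v]; first exact: dF.
apply/IH => i j; have [_ /(_ v)] := Fk i j x Ux.
by apply: (eq_Ck Uo) => y Uy; rewrite derive_coord//; exact: dF.
Qed.

Lemma smooth_differentiable (V : normedModType R) U (f : 'rV[R]_n -> V) x :
  smooth_on U f -> U x -> differentiable f x.
Proof. by move=> /(_ 1%N) /[apply] -[]. Qed.

Lemma smooth_derive (V : normedModType R) U (f : 'rV[R]_n -> V) v :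
  smooth_on U f -> smooth_on U ('D_v f).
Proof.
(* [Ck k.+1] yields the regularity of the derivatives only from a point of [U]; since [Ck k] itself
   starts by quantifying over such points, one may be fixed beforehand. *)
move=> fs k; suff: forall x, U x -> Ck k U ('D_v f).
  by case: k => [|k] H x Ux; exact: (H x Ux x Ux).
by move=> x Ux; have [_] := fs k.+1 x Ux; exact.
Qed.

Lemma eq_smooth (V : normedModType R) U (f g : 'rV[R]_n -> V) : open U ->
  (forall x, U x -> f x = g x) -> smooth_on U f -> smooth_on U g.
Proof. by move=> Uo fg fs k; exact: eq_Ck fg (fs k). Qed.

Lemma smooth_sum U p (f : 'I_p -> 'rV[R]_n -> R) : open U ->
  (forall i, smooth_on U (f i)) -> smooth_on U (fun x => \sum_i f i x).
Proof.
move=> Uo; elim: p f => [|p IH] f fs k.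
  by apply: eq_Ck (Ck_cst k 0 Uo) => // x _; rewrite big_ord0.
have fsS : smooth_on U (fun x => \sum_i f (lift ord0 i) x) by apply: IH.
apply: eq_Ck (CkD Uo (fs ord0 k) (fsS k)) => // x _.
by rewrite big_ord_recl.
Qed.

Lemma smooth_mxP p q U (F : 'rV[R]_n -> 'M[R]_(p, q)) : open U ->
  smooth_on U F <-> forall i j, smooth_on U (fun x => F x i j).
Proof.
move=> Uo; split=> [Fs i j k|Fs k]; first exact: (Ck_mxP k F Uo).1 (Fs k) i j.
by apply/(Ck_mxP k F Uo) => i j; exact: Fs.
Qed.

Lemma smooth_mulmx p q r U (F : 'rV[R]_n -> 'M[R]_(p, q))
    (G : 'rV[R]_n -> 'M[R]_(q, r)) : open U ->
  smooth_on U F -> smooth_on U G -> smooth_on U (fun x => F x *m G x).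
Proof.
move=> Uo /(smooth_mxP _ Uo) Fs /(smooth_mxP _ Uo) Gs.
apply/(smooth_mxP _ Uo) => i j; under eq_fun do rewrite mxE.
by apply: smooth_sum => // k l; apply: CkM; [|exact: Fs|exact: Gs].
Qed.

Lemma smooth_trmx p q U (F : 'rV[R]_n -> 'M[R]_(p, q)) : open U ->
  smooth_on U F -> smooth_on U (fun x => (F x)^T).
Proof.
move=> Uo /(smooth_mxP _ Uo) Fs; apply/(smooth_mxP _ Uo) => i j.
by under eq_fun do rewrite mxE; exact: Fs.
Qed.

Lemma smooth_scalemx p q U (f : 'rV[R]_n -> R) (F : 'rV[R]_n -> 'M[R]_(p, q)) :
  open U -> smooth_on U f -> smooth_on U F -> smooth_on U (fun x => f x *: F x).
Proof.
move=> Uo fs /(smooth_mxP _ Uo) Fs; apply/(smooth_mxP _ Uo) => i j k.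
by under eq_fun do rewrite mxE; apply: CkM; [|exact: fs|exact: Fs].
Qed.

(** The values 1 and -1 are at distance 2, so on a ball of radius 1 in the target the function is
    constant, and its derivatives vanish on [U]. *)
Lemma smooth_locally_sign U (o : 'rV[R]_n -> R) : open U ->
  (forall x, U x -> o x = 1 \/ o x = -1) ->
  (forall x, U x -> {for x, continuous o}) -> smooth_on U o.
Proof.
move=> Uo o1 oc.
have near_cst x : U x -> \forall y \near x, o x = o y.
  move=> Ux; have nU := open_nbhs_nbhs (conj Uo Ux).
  have /(_ _ (nbhsx_ballx (o x) _ (@ltr01 R))) nb := oc x Ux.
  apply: (@filterS2 _ _ (nbhs_filter x) _ _ _ _ nU nb) => y Uy.
  rewrite /= -ball_normE /= => /ltr_normlP[].
  by case: (o1 x Ux) (o1 y Uy) => -> [] -> //; lra.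
case=> [|k] x Ux; first exact: oc.
split=> [|v].
  exact: (near_eq_differentiable (near_cst x Ux) (differentiable_cst (o x) x)).
apply: (eq_Ck Uo) (Ck_cst k (0 : R) Uo) => y Uy.
by rewrite -(near_eq_derive v (near_cst y Uy)) derive_cst.
Qed.

End Smooth.

(* [N] stands for the covariant derivative of [J] under a torsion-free connection
   with matrix [Gam]; the terms in [Gam] cancel in the Nijenhuis torsion. *)
Lemma nijenhuis_vanishes (R : realType) m (J : 'rV[R]_m -> 'M[R]_m)
    (X Y : 'rV[R]_m -> 'rV[R]_m) z (N Gam : 'rV[R]_m -> 'M[R]_m) :
  differentiable J z -> differentiable X z -> differentiable Y z ->
  (forall w, 'D_w J z = N w + (Gam w *m J z - J z *m Gam w)) ->
  (forall v w, v *m Gam w = w *m Gam v) ->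
  (forall w, N (w *m J z) = N w *m J z) ->
  let JX y := X y *m J y in
  let JY y := Y y *m J y in
  lie_bracket JX JY z - lie_bracket JX Y z *m J z
  - lie_bracket X JY z *m J z + lie_bracket X Y z *m J z *m J z = 0.
Proof.
(* After [NJ] the terms [b *m N a *m j] and [a *m N b *m j] coming from [JX, JY] cancel those of J
   [X, JY] and J [JX, Y]. *)
move=> dJ dX dY DJ GamC NJ /=; rewrite /lie_bracket !derive_mulmx// !DJ !NJ.
move: (J z) (X z) (Y z) GamC => j a b GamC.
move: ('D_(a *m j) Y z) ('D_(b *m j) X z) ('D_b X z) ('D_a Y z) => d1 d2 d3 d4.
rewrite !(mulmxDl, mulmxDr, mulNmx, mulmxN, mulmxA).
rewrite (GamC b (a *m j)) (GamC (b *m j) (a *m j)) (GamC b a) (GamC (b *m j) a).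
move: (d1 *m j) (d2 *m j) (d3 *m j) (d4 *m j) => e1 e2 e3 e4.
move: (e3 *m j) (e4 *m j) => f3 f4.
move: (b *m N a *m j) (a *m N b *m j) (a *m j *m Gam b *m j)
  (a *m j *m Gam (b *m j)) (a *m Gam (b *m j) *m j) (a *m Gam b *m j *m j).
by move=> *; apply/rowP => k; rewrite !mxE; ring.
Qed.

(** * Derivatives of block matrices *)

Section Blocks.
Context {R : realType}.

Lemma derive_comp_lsubmx m n (W : normedModType R) (f : 'rV[R]_m -> W)
    (z w : 'rV[R]_(m + n)) : differentiable f (lsubmx z) ->
  differentiable (f \o lsubmx) z /\
  'D_w (f \o lsubmx) z = 'D_(lsubmx w) f (lsubmx z).
Proof.
move=> df; have dl := @differentiable_lsubmx R 1 m n z.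
have dfl : differentiable (f \o lsubmx) z by exact: differentiable_comp.
split=> //; rewrite !deriveE// diff_comp//=; congr ('d f _ _).
by rewrite diff_lin//; exact: continuous_lsubmx.
Qed.

Lemma differentiable_block_mx (V : normedModType R) m1 m2 n1 n2
    (A : V -> 'M[R]_(m1, n1)) (B : V -> 'M[R]_(m1, n2))
    (C : V -> 'M[R]_(m2, n1)) (D : V -> 'M[R]_(m2, n2)) x :
  differentiable A x -> differentiable B x -> differentiable C x ->
  differentiable D x ->
  differentiable (fun y => block_mx (A y) (B y) (C y) (D y)) x.
Proof.
move=> /differentiable_mxP dA /differentiable_mxP dB /differentiable_mxP dC
  /differentiable_mxP dD; apply/differentiable_mxP => i j.
case: (split_ordP i) (split_ordP j) => k -> [] l ->; under eq_fun do
  rewrite ?block_mxEul ?block_mxEur ?block_mxEdl ?block_mxEdr.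
- exact: dA. - exact: dB. - exact: dC. - exact: dD.
Qed.

Lemma derive_block_mx (V : normedModType R) m1 m2 n1 n2
    (A : V -> 'M[R]_(m1, n1)) (B : V -> 'M[R]_(m1, n2))
    (C : V -> 'M[R]_(m2, n1)) (D : V -> 'M[R]_(m2, n2)) x v :
  differentiable A x -> differentiable B x -> differentiable C x ->
  differentiable D x ->
  'D_v (fun y => block_mx (A y) (B y) (C y) (D y)) x
  = block_mx ('D_v A x) ('D_v B x) ('D_v C x) ('D_v D x).
Proof.
move=> dA dB dC dD; apply/matrixP => i j; rewrite derive_coord//; last first.
  exact: differentiable_block_mx.
case: (split_ordP i) (split_ordP j) => k -> [] l ->; under eq_fun do
  rewrite ?block_mxEul ?block_mxEur ?block_mxEdl ?block_mxEdr.
- by rewrite block_mxEul derive_coord.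
- by rewrite block_mxEur derive_coord.
- by rewrite block_mxEdl derive_coord.
- by rewrite block_mxEdr derive_coord.
Qed.

End Blocks.

(** * The Levi-Civita connection in a chart *)

Section CrossMatrixCalculus.
Context {R : realType}.

Lemma smooth_crossmx n (U : set 'rV[R]_n) (f : 'rV[R]_n -> 'rV[R]_3) : open U ->
  smooth_on U f -> smooth_on U (fun x => crossmx (f x)).
Proof.
move=> Uo /(smooth_mxP _ Uo) fs; apply/(smooth_mxP _ Uo).
have fN k : smooth_on U (fun x => - f x 0 k).
  by move=> l; apply: CkN => //; exact: fs.
have f0 : smooth_on U (fun=> 0 : R) by move=> l; exact: Ck_cst.
by apply: ord3P; apply: ord3P; under eq_fun do rewrite crossmxE /=;
  first [exact: f0 | exact: fs | exact: fN].
Qed.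

Lemma derive_crossmx (V : normedModType R) (f : V -> 'rV[R]_3) x v :
  differentiable f x -> differentiable (fun y => crossmx (f y)) x ->
  'D_v (fun y => crossmx (f y)) x = crossmx ('D_v f x).
Proof.
move=> df dc; apply/matrixP => i j; rewrite derive_coord// crossmxE.
under eq_fun do rewrite crossmxE.
move: (df) => /differentiable_mxP cf.
by move: i j; apply: ord3P; apply: ord3P;
  rewrite /= ?derive_cst ?deriveN ?derive_coord//; exact: diff_derivable.
Qed.

(** Jacobi's formula, as tr (G^-1 dG) = 2 tr P for dG = P G + G P^T, the form in which metric
    compatibility provides dG. *)
Lemma derive_det3 (V : normedModType R) (G : V -> 'M[R]_3) x v (P : 'M[R]_3) :
  differentiable G x -> 'D_v G x = P *m G x + G x *m P^T ->
  'D_v (fun y => \det (G y)) x = 2 * \tr P * \det (G x).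
Proof.
move=> dG dGE.
have cG (i j : 'I_3) : is_derive x v (fun y => G y i j) ('D_v G x i j).
  rewrite derive_coord//; apply: derivableP; apply: diff_derivable.
  by move/differentiable_mxP: dG.
pose g i j := fun y => G y i j.
have -> : (fun y => \det (G y)) =
  g i0 i0 * (g i1 i1 * g i2 i2 - g i1 i2 * g i2 i1)
  - g i0 i1 * (g i1 i0 * g i2 i2 - g i1 i2 * g i2 i0)
  + g i0 i2 * (g i1 i0 * g i2 i1 - g i1 i1 * g i2 i0).
  by apply/funext => y; rewrite det3E.
have {}cG i j : is_derive x v (g i j) ('D_v G x i j) by exact: cG.
rewrite derive_val dGE det3E /mxtrace.
have mulE (A B : 'M[R]_3) i j : (A *m B) i j =
    A i i0 * B i0 j + A i i1 * B i1 j + A i i2 * B i2 j by rewrite mxE sum3E.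
have addE (A B : 'M[R]_3) i j : (A + B) i j = A i j + B i j by rewrite mxE.
have trE (A : 'M[R]_3) i j : A^T i j = A j i by rewrite mxE.
rewrite !addE !mulE !trE sum3E.
by rewrite /g !fctE /GRing.scale /=; ring.
Qed.

End CrossMatrixCalculus.

Section Koszul.
Context {R : realType} {n : nat}.
Variables (G : 'rV[R]_n -> 'M[R]_n) (x : 'rV[R]_n).
Hypothesis dG : differentiable G x.

Lemma derive_ip u v w :
  'D_w (fun y => ip (G y) u v) x = ip ('D_w G x) u v.
Proof.
have dc p q (A : 'M[R]_(p, q)) : differentiable (fun=> A : 'M[R]_(p, q)) x.
  exact: differentiable_cst.
have duG : differentiable (fun y => u *m G y) x by exact: differentiable_mulmx.
rewrite -(derive_coord (F := fun y => u *m G y *m v^T)); last first.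
  exact: differentiable_mulmx.
by rewrite !derive_mulmx// !derive_cst mulmx0 addr0 mul0mx add0r.
Qed.

Lemma ipDl (A : 'M[R]_n) c u v w : ip A (c *: u + v) w = c * ip A u w + ip A v w.
Proof. by rewrite /ip !mulmxDl -!scalemxAl !mxE. Qed.

Lemma ipDr (A : 'M[R]_n) c u v w : ip A w (c *: u + v) = c * ip A w u + ip A w v.
Proof. by rewrite /ip linearP /= mulmxDr -scalemxAr !mxE. Qed.

Lemma ip_linear (A B : 'M[R]_n) c u v :
  ip (c *: A + B) u v = c * ip A u v + ip B u v.
Proof. by rewrite /ip mulmxDr mulmxDl -scalemxAr -scalemxAl !mxE. Qed.

Lemma ip_delta (A : 'M[R]_n) i j : ip A (delta_mx 0 i) (delta_mx 0 j) = A i j.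
Proof.
by rewrite /ip trmx_delta -rowE -colE !mxE.
Qed.

Definition koszul u v w : R := 2^-1 *
  (ip ('D_u G x) v w + ip ('D_v G x) u w - ip ('D_w G x) u v).

Lemma christoffel_koszul u v :
  christoffel G x u v = (\row_k koszul u v (delta_mx 0 k)) *m invmx (G x).
Proof.
congr (_ *m _); apply/rowP => k.
by rewrite [LHS]mxE [RHS]mxE /koszul !derive_ip.
Qed.

Lemma koszul_linear c u v1 v2 w :
  koszul u (c *: v1 + v2) w = c * koszul u v1 w + koszul u v2 w.
Proof.
rewrite /koszul (derive_dirP c v1 v2 dG).
move: ('D_u G x) ('D_v1 G x) ('D_v2 G x) ('D_w G x) => A B C D.
rewrite (ip_linear B C) (ipDl A c v1) (ipDr D c v1).
ring.
Qed.

(** The connection form evaluated on [u]: nabla_u Y is the derivative of Y plus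
    [Y *m connection_mx u]. *)
Definition connection_mx u : 'M[R]_n :=
  \matrix_i christoffel G x u (delta_mx 0 i).

Hypothesis Gsym : \forall y \near x, (G y)^T = G y.
Hypothesis Gunit : G x \in unitmx.

Lemma derive_metric_sym u : ('D_u G x)^T = 'D_u G x.
Proof.
by rewrite -derive_trmx//; exact: near_eq_derive.
Qed.

Lemma ipC (A : 'M[R]_n) u v : A^T = A -> ip A u v = ip A v u.
Proof.
move=> Asym; rewrite /ip.
have -> : u *m A *m v^T = (v *m A *m u^T)^T.
  by rewrite !trmx_mul trmxK Asym mulmxA.
by rewrite mxE.
Qed.

Lemma koszulC u v w : koszul u v w = koszul v u w.
Proof.
rewrite /koszul; move: (derive_metric_sym w).
move: ('D_u G x) ('D_v G x) ('D_w G x) => A B C Csym.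
by rewrite (ipC u v Csym) [ip A v w + _]addrC.
Qed.

Lemma christoffelC u v : christoffel G x u v = christoffel G x v u.
Proof.
rewrite !christoffel_koszul; congr (_ *m _).
by apply/rowP => k; rewrite [LHS]mxE [RHS]mxE koszulC.
Qed.

Lemma christoffelE u v : christoffel G x u v = v *m connection_mx u.
Proof.
have lin : linear (christoffel G x u).
  move=> c v1 v2; rewrite !christoffel_koszul scalemxAl -mulmxDl.
  congr (_ *m _); apply/rowP => k.
  rewrite [LHS]mxE [RHS]mxE koszul_linear; congr (_ + _).
    by rewrite [RHS]mxE; congr (_ * _); rewrite [RHS]mxE.
  by rewrite [RHS]mxE.
pose f : {linear 'rV[R]_n -> 'rV[R]_n} :=
  HB.pack (christoffel G x u) (GRing.isLinear.Build _ _ _ _ _ lin).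
have -> : connection_mx u = lin1_mx f.
  by apply/matrixP => i j; rewrite [LHS]mxE [RHS]mxE.
by rewrite mul_rV_lin1.
Qed.

(** Metric compatibility: in the sum of the Koszul expression and its transpose, the last two terms
    cancel and the halves of ['D_u G x] add up. *)
Lemma derive_metric u :
  'D_u G x = connection_mx u *m G x + G x *m (connection_mx u)^T.
Proof.
have kos i j : (connection_mx u *m G x) i j = 2^-1 *
    ('D_u G x i j + ip ('D_(delta_mx 0 i) G x) u (delta_mx 0 j)
     - ip ('D_(delta_mx 0 j) G x) u (delta_mx 0 i)).
  have -> : (connection_mx u *m G x) i j
      = (row i (connection_mx u *m G x)) 0 j by rewrite [RHS]mxE.
  rewrite row_mul rowK christoffel_koszul mulmxKV// [LHS]mxE.
  rewrite /koszul; move: ('D_u G x) => A.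
  by rewrite (ip_delta A).
have Gx : (G x)^T = G x := nbhs_singleton Gsym.
apply/matrixP => i j; rewrite [RHS]mxE kos.
have -> : (G x *m (connection_mx u)^T) i j = (connection_mx u *m G x) j i.
  rewrite -[in LHS]Gx -trmx_mul; exact: mxE.
rewrite kos; have -> : 'D_u G x j i = 'D_u G x i j.
  rewrite -[in LHS]derive_metric_sym; exact: mxE.
by field.
Qed.

End Koszul.

(** * Unit Killing fields in a chart *)

Lemma ip_mx (R : realType) n (G : 'M[R]_n) u v : u *m G *m v^T = (ip G u v)%:M.
Proof. exact: mx11_scalar. Qed.

Section UnitKillingField.
Context {R : realType}.
Variables (U : set 'rV[R]_3) (G : 'rV[R]_3 -> 'M[R]_3) (o : 'rV[R]_3 -> R).
Variables (xi : 'rV[R]_3 -> 'rV[R]_3) (tau : 'rV[R]_3 -> R).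
Hypothesis Uo : open U.
Hypothesis Gsmooth : smooth_on U G.
Hypothesis Gsym : forall x, U x -> (G x)^T = G x.
Hypothesis Gpos : forall x u, U x -> u != 0 -> 0 < ip (G x) u u.
Hypothesis o_sign : forall x, U x -> o x = 1 \/ o x = -1.
Hypothesis o_cont : forall x, U x -> {for x, continuous o}.
Hypothesis xi_smooth : smooth_on U xi.
Hypothesis xi_unit : forall x, U x -> ip (G x) (xi x) (xi x) = 1.
Hypothesis nabla_xi : forall x u, U x ->
  nabla G x u xi = tau x *: cross (o x) (G x) u (xi x).

Definition vol_density x := o x * Num.sqrt (\det (G x)).
Definition reeb_form x := metric_dual (G x) (xi x).
Definition reeb_endo x := cross_endo (G x) (vol_density x) (xi x).
Local Notation s := vol_density.
Local Notation eta := reeb_form.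
Local Notation phi := reeb_endo.

Lemma det_metric_gt0 x : U x -> 0 < \det (G x).
Proof. by move=> Ux; apply: posdef3_det_gt0 => [|u]; [exact: Gsym|exact: Gpos]. Qed.

Lemma vol_density_sq x : U x -> s x ^+ 2 = \det (G x).
Proof.
move=> Ux; rewrite exprMn sqr_sqrtr ?ltW ?det_metric_gt0//.
by case: (o_sign Ux) => ->; rewrite ?sqrrN expr1n mul1r.
Qed.

Lemma vol_density_neq0 x : U x -> s x != 0.
Proof.
by move=> Ux; rewrite -sqrf_eq0 vol_density_sq// gt_eqF// det_metric_gt0.
Qed.

Lemma metric_unitmx x : U x -> G x \in unitmx.
Proof. by move=> Ux; rewrite unitmxE unitfE gt_eqF// det_metric_gt0. Qed.

Lemma xi_metric x : U x -> xi x *m G x *m (xi x)^T = 1%:M.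
Proof. by move=> Ux; rewrite ip_mx xi_unit. Qed.

Lemma vol_density_smooth : smooth_on U s.
Proof.
move=> k; apply: CkM => //; first exact: smooth_locally_sign.
apply: Ck_sqrt => //; first exact: det_metric_gt0.
have Gk i j : Ck k U (fun x => G x i j).
  exact: ((smooth_mxP _ Uo).1 Gsmooth).
under eq_fun do rewrite det3E.
by repeat first [exact: Gk | apply: CkN => // | apply: CkD => // | apply: CkM => //].
Qed.

Lemma reeb_form_smooth : smooth_on U eta.
Proof. by apply: smooth_mulmx => //; exact: smooth_trmx. Qed.

Lemma vol_density_inv_smooth : smooth_on U (fun x => (s x)^-1).
Proof.
by move=> k; apply: CkV => //; [exact: vol_density_neq0|exact: vol_density_smooth].
Qed.

Lemma reeb_endo_smooth : smooth_on U phi.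
Proof.
apply: (@eq_smooth _ _ _ _
  (fun x => (s x)^-1 *: (G x *m crossmx (eta x)^T)) _ Uo) => [x Ux|].
  by rewrite -cross_endoE ?vol_density_sq ?vol_density_neq0 ?Gsym.
apply: smooth_scalemx => //; first exact: vol_density_inv_smooth.
apply: smooth_mulmx => //; apply: smooth_crossmx => //.
by apply: smooth_trmx => //; exact: reeb_form_smooth.
Qed.

Section AtPoint.
Variable x : 'rV[R]_3.
Hypothesis Ux : U x.

Let dG : differentiable G x. Proof. exact: smooth_differentiable Ux. Qed.
Let dxi : differentiable xi x. Proof. exact: smooth_differentiable Ux. Qed.
Let ds : differentiable s x.
Proof. exact: smooth_differentiable vol_density_smooth Ux. Qed.
Let nearU (P : 'rV[R]_3 -> Prop) : (forall y, U y -> P y) -> \forall y \near x, P y.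
Proof. by move=> UP; apply: filterS UP _; exact: open_nbhs_nbhs. Qed.
Local Notation Gam := (connection_mx G x).

Lemma connection_mxC u v : u *m Gam v = v *m Gam u.
Proof.
have sym := nearU Gsym.
by rewrite -(christoffelE dG v) -(christoffelE dG u) christoffelC.
Qed.

Lemma derive_metric_connection u :
  'D_u G x = Gam u *m G x + G x *m (Gam u)^T.
Proof. by apply: derive_metric => //; [exact: nearU|exact: metric_unitmx]. Qed.

(** The minus sign arises because the curvature equation has u /\ xi whereas phi u = xi /\ u. *)
Lemma derive_xi u :
  'D_u xi x = - (tau x) *: (u *m phi x) - xi x *m Gam u.
Proof.
have := nabla_xi u Ux.
rewrite /nabla christoffelE//.
move=> /(canRL (addrK _)) ->; congr (_ - _).
rewrite scaleNr -scalerN; congr (_ *: _); rewrite /cross /reeb_endo /cross_endo.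
have -> : (\row_k volume_form (o x) (G x) u (xi x) (delta_mx 0 k))
    = s x *: (xi x *m crossmx u).
  by rewrite -row_det_crossmx; apply/rowP => k; rewrite [LHS]mxE !mxE.
by rewrite mul_crossmxC scalerN mulNmx -scalemxAl -scalemxAr mulmxA.
Qed.

(** The volume form is parallel. Differentiating s^2 = det G gives 2 s D_u s = 2 s^2 tr Gam, where 2
    s can be cancelled. *)
Lemma derive_vol_density u : 'D_u s x = s x * \tr (Gam u).
Proof.
have d2 : 'D_u (fun y => s y * s y) x = 'D_u (fun y => \det (G y)) x.
  by apply: near_eq_derive; apply: nearU => y Uy; rewrite -vol_density_sq.
move: d2; rewrite (derive_det3 dG (derive_metric_connection u)).
rewrite deriveM; [|exact: diff_derivable..].
rewrite -vol_density_sq// /GRing.scale /= => d2.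
apply: (mulfI (vol_density_neq0 Ux)); apply: (mulfI (_ : 2 != 0 :> R)) => //.
by ring: d2.
Qed.

(** In covariant terms, nabla_u eta = g(nabla_u xi, .): the metric is parallel. *)
Lemma derive_reeb_form u : 'D_u eta x =
  Gam u *m eta x - tau x *: (G x *m (u *m phi x)^T).
Proof.
rewrite derive_mulmx//; last exact: differentiable_trmx.
rewrite derive_metric_connection derive_trmx// derive_xi linearB linearZ /=.
rewrite [(xi x *m _)^T]trmx_mul mulmxDl mulmxBr -!mulmxA -scalemxAr scaleNr.
by rewrite addrA addrAC addrK.
Qed.

(* The last term is [(nabla_u phi) v = tau (g(u, v) xi - eta(v) u)]. *)
Lemma derive_reeb_endo u : 'D_u phi x = Gam u *m phi x - phi x *m Gam u
  + tau x *: (G x *m u^T *m xi x - eta x *m u).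
Proof.
have dphi : differentiable phi x.
  exact: smooth_differentiable reeb_endo_smooth Ux.
have dC : differentiable (fun y => crossmx (xi y)) x.
  exact: smooth_differentiable (smooth_crossmx Uo xi_smooth) Ux.
(* Differentiating phi G instead of phi avoids the derivative of the inverse of [G]. *)
have eqG : 'D_u (fun y => phi y *m G y) x = 'D_u (fun y => s y *: crossmx (xi y)) x.
  apply: near_eq_derive; apply: nearU => y Uy.
  by apply: cross_endo_metric; [exact: vol_density_sq|exact: vol_density_neq0].
have phiG : phi x *m G x = s x *: crossmx (xi x).
  by apply: cross_endo_metric; [exact: vol_density_sq|exact: vol_density_neq0].
have phi_u : s x *: crossmx (u *m phi x)
    = (eta x *m u - G x *m u^T *m xi x) *m G x.
  have <- := crossmx_cross_endo (xi x) (vol_density_sq Ux) (vol_density_neq0 Ux)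
    (Gsym Ux) u.
  by rewrite mulmxKV// metric_unitmx.
apply: (can_inj (mulmxK (metric_unitmx Ux))).
move: eqG; rewrite derive_mulmx// derive_scalemx// derive_crossmx//.
rewrite derive_vol_density derive_xi derive_metric_connection.
move=> /(canRL (addrK _)) ->.
have -> : s x *: crossmx (- tau x *: (u *m phi x) - xi x *m Gam u) =
    - tau x *: ((eta x *m u - G x *m u^T *m xi x) *m G x)
    - s x *: crossmx (xi x *m Gam u).
  by rewrite crossmxB crossmxZ scalerBr scalerA [s x * _]mulrC -scalerA phi_u.
(* The trace from the density splits in three: one term cancels the connection term of xi, one
   cancels that of the factor [G], and the last is [Gam u *m phi x]. *)
rewrite -scalerA crossmx_trace !scalerDr !mulmxDl mulmxDr.
rewrite [s x *: (Gam u *m _)]scalemxAr [s x *: (crossmx _ *m _)]scalemxAl -phiG.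
rewrite -![(tau x *: _) *m _]scalemxAl !mulNmx !mulmxA.
move: (s x *: _) (_ *m phi x *m _) (_ *m (Gam u)^T) (eta x *m u *m _)
  (_ *m xi x *m _) (_ *m Gam u *m _) => A1 A2 A3 A4 A5 A6.
by apply/matrixP => i j; rewrite !mxE; ring.
Qed.

Lemma reeb_endo_skew u v : ip (G x) u (v *m phi x) = - ip (G x) (u *m phi x) v.
Proof.
have sk := cross_endo_skew (xi x) (vol_density_sq Ux) (vol_density_neq0 Ux)
  (Gsym Ux).
rewrite /ip trmx_mul mulmxA -[u *m G x *m _]mulmxA sk mulmxN mulNmx.
by rewrite mulmxA [LHS]mxE.
Qed.

(** The connection terms cancel by symmetry, and the two curvature terms are equal by skewness of
    phi. The factor 1/2 in the convention for d eta absorbs this doubling, so that tau, not 2 tau,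
    is the scale of g'. *)
Lemma curl_reeb_form u v :
  2^-1 * ((v *m 'D_u eta x) 0 0 - (u *m 'D_v eta x) 0 0)
  = tau x * ip (G x) u (v *m phi x).
Proof.
have E (A : 'M[R]_1) (c k : R) : (A - c *: k%:M) 0 0 = A 0 0 - c * k.
  by rewrite !mxE mulr1n.
have D a b : (a *m 'D_b eta x) 0 0 =
    (a *m Gam b *m eta x) 0 0 - tau x * ip (G x) a (b *m phi x).
  by rewrite derive_reeb_form mulmxBr -scalemxAr ![a *m (_ *m _)]mulmxA
    (ip_mx (G x)) E.
have skew : ip (G x) v (u *m phi x) = - ip (G x) u (v *m phi x).
  exact: etrans (reeb_endo_skew v u) (congr1 -%R (ipC (v *m phi x) u (Gsym Ux))).
have half (A t X Y : R) : X = - Y -> 2^-1 * ((A - t * X) - (A - t * Y)) = t * Y.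
  by move=> ->; field.
apply: etrans (half _ _ _ _ skew); congr (_ * (_ - _)); first exact: D.
by apply: (etrans (D u v)); rewrite (connection_mxC u v).
Qed.

Lemma reeb_endo_compat u v : ip (G x) (u *m phi x) (v *m phi x)
  = ip (G x) u v - (u *m eta x) 0 0 * (v *m eta x) 0 0.
Proof.
have sq := cross_endo_sq (vol_density_sq Ux) (vol_density_neq0 Ux)
  (Gsym Ux) (xi_metric Ux).
rewrite (reeb_endo_skew (u *m phi x) v) -mulmxA sq mulmxBr mulmx1 mulmxA.
have E (A B : 'M[R]_1) : - (A - B) 0 0 = B 0 0 - A 0 0 by rewrite !mxE opprB.
rewrite /ip !mulmxBl E; congr (_ - _).
rewrite -2!mulmxA {1}[u *m eta x]mx11_scalar mul_scalar_mx [LHS]mxE; congr (_ * _).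
by rewrite mulmxA; have := ipC (xi x) v (Gsym Ux); rewrite /ip => ->; rewrite mulmxA.
Qed.

End AtPoint.

(* [tau] is only given as a function on the base: its smoothness is read off the
   exterior derivative of [eta], whose matrix is [- tau s crossmx xi]. *)
Lemma tau_smooth : smooth_on U tau.
Proof.
pose K y : 'M[R]_3 := \matrix_(i, j)
  (2^-1 * ('D_(delta_mx 0 i) eta y j 0 - 'D_(delta_mx 0 j) eta y i 0)).
have Ksmooth : smooth_on U K.
  apply/(smooth_mxP _ Uo) => i j k; under eq_fun do rewrite mxE.
  apply: CkM => //; first exact: Ck_cst.
  have De l m : Ck k U (fun y => 'D_(delta_mx 0 l) eta y m 0).
    have Del : smooth_on U ('D_(delta_mx 0 l) eta).
      by apply: smooth_derive; exact: reeb_form_smooth.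
    exact: ((smooth_mxP _ Uo).1 Del).
  by apply: CkD => //; apply: CkN.
(* As eta(xi) = 1, the trace of [crossmx xi *m crossmx eta^T] is 1 - 3 = -2. The trace of [L] is
   therefore 2 tau s, which can be divided by 2 s. *)
pose L y := K y *m crossmx (eta y)^T.
have Lsmooth : smooth_on U L.
  apply: smooth_mulmx => //; apply: smooth_crossmx => //; apply: smooth_trmx => //.
  exact: reeb_form_smooth.
apply: (@eq_smooth _ _ _ _ (fun y => 2^-1 * (s y)^-1 * \sum_i L y i i) _ Uo);
  last first.
  move=> k; apply: CkM => //.
    apply: CkM => //; first exact: Ck_cst.
    exact: vol_density_inv_smooth.
  by apply: smooth_sum => // i; exact: ((smooth_mxP _ Uo).1 Lsmooth).
move=> x Ux.
have KE : K x = - (tau x * s x) *: crossmx (xi x).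
  apply/matrixP => i j; rewrite [LHS]mxE.
  have phiG := cross_endo_metric (xi x) (vol_density_sq Ux) (vol_density_neq0 Ux).
  have rowE0 (A : 'cV[R]_3) k : ((delta_mx 0 k : 'rV[R]_3) *m A) 0 0 = A k 0.
    by rewrite -rowE [LHS]mxE.
  have curl := curl_reeb_form Ux (delta_mx 0 i) (delta_mx 0 j).
  apply: (etrans (etrans _ curl)).
    by congr (_ * (_ - _)); exact: esym (rowE0 _ _).
  rewrite (reeb_endo_skew Ux (delta_mx 0 i)) /ip.
  rewrite -(mulmxA (delta_mx 0 i) (phi x)) phiG -/(ip _ _ _) ip_delta.
  by rewrite [in LHS]mxE [RHS]mxE mulrN mulrA mulNr.
have trL : \sum_i L x i i = \tr (L x) by [].
have xe : xi x *m eta x = 1%:M := mul_xi_dual (xi_metric Ux).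
rewrite trL /L KE -scalemxAl mul_crossmx trmxK xe mxtraceZ raddfB /=.
rewrite mxtrace_mulC xe mxtraceZ !mxtrace1 mxE eqxx.
have := vol_density_neq0 Ux; rewrite /GRing.scale /= => s0.
by field.
Qed.

(** * The Sasakian metric in a chart *)

Definition reeb_metric x := tau x *: G x + (1 - tau x) *: (eta x *m (eta x)^T).

Lemma ip_reeb_metric x u v : ip (reeb_metric x) u v
  = tau x * ip (G x) u v + (1 - tau x) * ((u *m eta x) 0 0 * (v *m eta x) 0 0).
Proof.
rewrite /reeb_metric ip_linear; congr (_ + _).
rewrite /ip -scalemxAr -scalemxAl [LHS]mxE; congr (_ * _).
rewrite (mulmxA u) -(mulmxA (u *m eta x)) -trmx_mul [v *m _]mx11_scalar tr_scalar_mx.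
by rewrite [u *m _]mx11_scalar -scalar_mxM !mxE eqxx.
Qed.

Lemma reeb_metric_smooth : smooth_on U reeb_metric.
Proof.
apply/(smooth_mxP _ Uo) => i j k.
have Gk : Ck k U (fun x => G x i j) by exact: ((smooth_mxP _ Uo).1 Gsmooth).
have ek l : Ck k U (fun x => eta x l 0).
  by exact: ((smooth_mxP _ Uo).1 reeb_form_smooth).
have tk := tau_smooth k.
apply: (@eq_Ck _ _ _ _ _
  (fun x => tau x * G x i j + (1 - tau x) * (eta x i 0 * eta x j 0)) _ Uo).
  by move=> x _; rewrite !mxE big_ord1 !mxE.
apply: CkD => //; apply: CkM => //; last exact: CkM.
by apply: CkD => //; [exact: Ck_cst|exact: CkN].
Qed.

(** The coefficient 1 - tau may be negative, but g' (u, u) = tau g(phi u, phi u) + eta(u)^2. Both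
    terms vanish only if phi u = 0 and eta(u) = 0, and then phi^2 = -1 + eta xi gives u = 0. *)
Lemma reeb_metric_gt0 x u : U x -> 0 < tau x -> u != 0 ->
  0 < ip (reeb_metric x) u u.
Proof.
move=> Ux tau0 u0; rewrite ip_reeb_metric.
have E := reeb_endo_compat Ux u u.
have [up|up] := eqVneq (u *m phi x) 0; last first.
  have := Gpos Ux up; rewrite {}E; nra.
have sq := cross_endo_sq (vol_density_sq Ux) (vol_density_neq0 Ux)
  (Gsym Ux) (xi_metric Ux).
have ue0 : (u *m eta x) 0 0 != 0.
  apply: contra_neq u0 => ue.
  have : u *m (phi x *m phi x) = 0 by rewrite mulmxA up mul0mx.
  rewrite sq mulmxBr mulmx1 mulmxA [u *m _]mx11_scalar ue.
  rewrite mul_scalar_mx scale0r sub0r.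
  by move/eqP; rewrite oppr_eq0 => /eqP.
have : 0 < (u *m eta x) 0 0 ^+ 2 by rewrite exprn_even_gt0.
have -> : ip (G x) u u = (u *m eta x) 0 0 * (u *m eta x) 0 0.
  by apply/eqP; rewrite -subr_eq0 -E up /ip !mul0mx mxE.
by rewrite expr2; lra.
Qed.

Lemma reeb_metric_compat x u v : U x ->
  ip (reeb_metric x) (u *m phi x) (v *m phi x)
  = ip (reeb_metric x) u v - (u *m eta x) 0 0 * (v *m eta x) 0 0.
Proof.
move=> Ux; have pe : phi x *m eta x = 0.
  exact: mul_cross_endo_dual (vol_density_sq Ux) (vol_density_neq0 Ux).
rewrite !ip_reeb_metric (reeb_endo_compat Ux) -!(mulmxA _ (phi x)) pe !mulmx0.
by rewrite [(0 : 'M[R]_1) 0 0]mxE; ring.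
Qed.

(** The derivatives of X and Y cancel against the Lie bracket, and eta (phi Y) = 0 removes the
    second term of g'. *)
Lemma reeb_contact (X Y : 'rV[R]_3 -> 'rV[R]_3) x :
  smooth_on U X -> smooth_on U Y -> U x ->
  ip (reeb_metric x) (X x) (Y x *m phi x) = ext_derivative eta X Y x.
Proof.
move=> Xs Ys Ux; rewrite ip_reeb_metric.
have pe : phi x *m eta x = 0.
  exact: mul_cross_endo_dual (vol_density_sq Ux) (vol_density_neq0 Ux).
rewrite -[Y x *m phi x *m eta x]mulmxA pe mulmx0 [(0 : 'M[R]_1) 0 0]mxE !mulr0 addr0.
rewrite -(curl_reeb_form Ux); congr (_ * _).
have de : differentiable eta x by exact: smooth_differentiable reeb_form_smooth Ux.
have D (Z : 'rV[R]_3 -> 'rV[R]_3) a : smooth_on U Z ->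
    'D_a (fun y => (Z y *m eta y) 0 0) x =
    ('D_a Z x *m eta x) 0 0 + (Z x *m 'D_a eta x) 0 0.
  move=> Zs; have dZ := smooth_differentiable Zs Ux.
  rewrite -(derive_coord (F := fun y => Z y *m eta y)).
    by rewrite derive_mulmx// [LHS]mxE.
  exact: differentiable_mulmx.
have sum (A B : 'M[R]_1) (a b : R) :
    a - b = (A 0 0 + a) - (B 0 0 + b) - (A - B) 0 0 by rewrite !mxE; ring.
by rewrite (D Y (X x) Ys) (D X (Y x) Xs) /lie_bracket mulmxBl; exact: sum.
Qed.

(** * The almost complex structure on M x R *)

Let J x := acs_mx (G x) (s x) (xi x).

Lemma product_acsE z w : product_acs phi eta xi z w = w *m J (lsubmx z).
Proof.
rewrite /product_acs /J /acs_mx -[in RHS](hsubmxK w) mul_row_block.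
by rewrite mulmx0 addr0 [rsubmx w in RHS]mx11_scalar mulmxN mul_scalar_mx.
Qed.

(** The connection is the product of that of g with the flat one on the line, so its matrix has only
    an upper left block. *)
Lemma derive_acs_mx x w : U x -> 'D_(lsubmx w) J x =
  tau x *: nabla_acs (G x) (s x) (xi x) w
  + (block_mx (connection_mx G x (lsubmx w)) 0 0 0 *m J x
     - J x *m block_mx (connection_mx G x (lsubmx w)) 0 0 0).
Proof.
move=> Ux; have dp := smooth_differentiable reeb_endo_smooth Ux.
have de := smooth_differentiable reeb_form_smooth Ux.
have dx := smooth_differentiable xi_smooth Ux.
have dn : differentiable (fun y => - xi y) x by exact: differentiableN.
have d0 : differentiable (fun _ : 'rV[R]_3 => 0 : 'M[R]_1) x.
  exact: differentiable_cst.
transitivity (block_mx ('D_(lsubmx w) phi x) ('D_(lsubmx w) eta x)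
    ('D_(lsubmx w) (fun y => - xi y) x)
    ('D_(lsubmx w) (fun _ : 'rV[R]_3 => 0 : 'M[R]_1) x)).
  exact: (derive_block_mx _ dp de dn d0).
rewrite derive_cst deriveN; last exact: diff_derivable.
rewrite derive_xi// derive_reeb_form// derive_reeb_endo//.
have sk := cross_endo_skew (xi x) (vol_density_sq Ux) (vol_density_neq0 Ux)
  (Gsym Ux).
rewrite /J /acs_mx /nabla_acs !mulmx_block scale_block_mx !mul0mx !mulmx0 !addr0.
rewrite opp_block_mx !add_block_mx; congr block_mx.
- by rewrite addrC.
- rewrite subr0 addrC; congr (_ + _).
  by rewrite trmx_mul mulmxA sk mulNmx scalerN opprK.
- by rewrite sub0r mulNmx opprK opprB scaleNr opprK addrC.
- by rewrite scaler0 subr0 addr0.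
Qed.

Lemma reeb_integrable :
  integrable_acs [set z | U (lsubmx z)] (product_acs phi eta xi).
Proof.
have -> : product_acs phi eta xi = fun z w => w *m J (lsubmx z).
  by apply/funext => z; apply/funext => w; exact: product_acsE.
move=> X Y Xs Ys z Uz /=.
have dJ : differentiable J (lsubmx z).
  apply: differentiable_block_mx.
  - exact: smooth_differentiable reeb_endo_smooth Uz.
  - exact: smooth_differentiable reeb_form_smooth Uz.
  - by apply: differentiableN; exact: smooth_differentiable xi_smooth Uz.
  - exact: differentiable_cst.
pose x := lsubmx z; have Ux : U x := Uz.
apply: (nijenhuis_vanishes (J := J \o lsubmx)
  (N := fun w => tau x *: nabla_acs (G x) (s x) (xi x) w)
  (Gam := fun w => block_mx (connection_mx G x (lsubmx w)) 0 0 0)).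
- by have [] := derive_comp_lsubmx 0 dJ.
- exact: smooth_differentiable Uz.
- exact: smooth_differentiable Uz.
- move=> w; have [_ ->] := derive_comp_lsubmx w dJ.
  exact: derive_acs_mx.
- move=> v w.
  have mul_block (t : 'rV[R]_(3 + 1)) (A : 'M[R]_3) :
      t *m (block_mx A 0 0 0 : 'M[R]_(3 + 1)) = row_mx (lsubmx t *m A) 0.
    by rewrite -[t in LHS]hsubmxK mul_row_block !mulmx0 !addr0.
  apply: (etrans (mul_block v _)); apply: (etrans _ (esym (mul_block w _))).
  exact: (congr1 (fun r => row_mx r (0 : 'rV[R]_1))
    (connection_mxC Ux (lsubmx v) (lsubmx w))).
- move=> w; rewrite -scalemxAl; congr (_ *: _).
  by apply: nabla_acs_mul; [exact: vol_density_sq|exact: vol_density_neq0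
    |exact: Gsym|exact: xi_metric].
Qed.

End UnitKillingField.

(** * Unit Killing fields on a manifold *)

Section ChangeOfCharts.
Context {R : realType} (n : nat) (M : manifold R n).

Lemma overlap_img (i j : chart M) x : chart_overlap i j x ->
  [/\ chart_img i x, chart_img j (transition i j x)
    & chart_inv j (transition i j x) = chart_inv i x].
Proof.
move=> [ix jx]; split=> //; last exact: chart_mapK.
by exists (chart_inv i x).
Qed.

End ChangeOfCharts.

(** The square root produces |det J|, and the sign in the transformation law of the orientation
    turns it into det J. *)
Lemma vol_density_change (R : realType) (G G' J : 'M[R]_3) (d d' : R) :
  G = J *m G' *m J^T -> 0 <= \det G' -> d = Num.sg (\det J) * d' ->
  d * Num.sqrt (\det G) = \det J * (d' * Num.sqrt (\det G')).
Proof.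
move=> -> G'0 ->; rewrite !det_mulmx det_tr.
have -> : \det J * \det G' * \det J = \det J ^+ 2 * \det G' by ring.
rewrite sqrtrM ?sqr_ge0//.
by rewrite sqrtr_sqr -[in RHS](mulr_sg_norm (\det J)); ring.
Qed.

Section UnitFieldOnManifold.
Variables (R : realType) (M : manifold R 3).
Variables (g : chart M -> 'rV[R]_3 -> 'M[R]_3) (o : chart M -> 'rV[R]_3 -> R).
Variables (xi : chart M -> 'rV[R]_3 -> 'rV[R]_3) (tau : M -> R).
Hypothesis g_metric : riemannian_metric g.
Hypothesis o_orient : orientation o.
Hypothesis xi_field : vector_field xi.
Hypothesis xi_unit : unit_field g xi.
Hypothesis tau_gt0 : forall p, 0 < tau p.
Hypothesis nabla_xi : forall i x u, chart_img i x ->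
  nabla (g i) x u (xi i) =
  tau (chart_inv i x) *: cross (o i x) (g i x) u (xi i x).

Let phi i := reeb_endo (g i) (o i) (xi i).
Let eta i := reeb_form (g i) (xi i).
Let g' i := reeb_metric (g i) (xi i) (fun x => tau (chart_inv i x)).

Let img_open (i : chart M) : open (chart_img i).
Proof. exact: chart_img_open. Qed.

Let g_smooth (i : chart M) : smooth_on (chart_img i) (g i).
Proof. by case: g_metric. Qed.

Let g_sym (i : chart M) x : chart_img i x -> (g i x)^T = g i x.
Proof. by case: g_metric => _ _ H _; exact: H. Qed.

Let g_pos (i : chart M) x u : chart_img i x -> u != 0 -> 0 < ip (g i x) u u.
Proof. by case: g_metric => _ _ _; exact. Qed.

Let o_sign (i : chart M) x : chart_img i x -> o i x = 1 \/ o i x = -1.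
Proof. by case: o_orient => H _ _; exact: H. Qed.

Let o_cont (i : chart M) x : chart_img i x -> {for x, continuous (o i)}.
Proof. by case: o_orient => _ H _; exact: H. Qed.

Let xi_smooth (i : chart M) : smooth_on (chart_img i) (xi i).
Proof. by have [/(_ i)] := xi_field; rewrite preimage_setT setIT. Qed.

Let xi1 (i : chart M) x : chart_img i x -> ip (g i x) (xi i x) (xi i x) = 1.
Proof. exact: xi_unit. Qed.

Let g_change (i j : chart M) x : chart_overlap i j x -> g i x =
  transition_jac i j x *m g j (transition i j x) *m (transition_jac i j x)^T.
Proof. by case: g_metric => _ H _ _; exact: H. Qed.

Let xi_change (i j : chart M) x : chart_overlap i j x ->
  xi j (transition i j x) = xi i x *m transition_jac i j x.
Proof. by move=> ij; have [_] := xi_field; apply. Qed.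

Let eta_change (i j : chart M) x : chart_overlap i j x ->
  eta i x = transition_jac i j x *m eta j (transition i j x).
Proof.
move=> ij; rewrite /eta /reeb_form /metric_dual (g_change ij) (xi_change ij).
by rewrite trmx_mul !mulmxA.
Qed.

Let phi_change (i j : chart M) x : chart_overlap i j x ->
  phi i x *m transition_jac i j x =
  transition_jac i j x *m phi j (transition i j x).
Proof.
move=> ij; have [ix jx _] := overlap_img ij.
rewrite /phi /reeb_endo (xi_change ij) -(cross_endo_change _ _ _ (g_change ij)).
  congr (_ *m _); congr (cross_endo _ _ _); apply: vol_density_change.
  - exact: g_change.
  - exact: ltW (det_metric_gt0 (@g_sym j) (@g_pos j) jx).
  - by case: o_orient => _ _; apply.
exact: (metric_unitmx (@g_sym i) (@g_pos i) ix).
Qed.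

Lemma sasakian_unit_field : sasakian_structure phi eta xi g'.
Proof.
have g'_metric : riemannian_metric g'.
  split=> [i|i j x ij|i x ix|i x u ix u0].
  - apply: (reeb_metric_smooth (o := o i)); [exact: img_open|exact: g_smooth
      |exact: g_sym|exact: g_pos|exact: o_sign|exact: o_cont|exact: xi_smooth
      |exact: xi1|by move=> x u; exact: nabla_xi].
  - have [ix jx inv] := overlap_img ij.
    rewrite /g' /reeb_metric inv {1}(g_change ij) -/(eta i x) (eta_change ij).
    rewrite mulmxDr mulmxDl -!scalemxAr -!scalemxAl; congr (_ + _ *: _).
    by rewrite trmx_mul !mulmxA.
  - rewrite /g' /reeb_metric linearD !linearZ /= trmx_mul trmxK.
    by rewrite g_sym.
  - exact: (reeb_metric_gt0 (@g_sym i) (@g_pos i) (@o_sign i) (@xi1 i) ix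
      (tau_gt0 _) u0).
split; first split; first split; first split => //.
- split=> [i|i j x]; last exact: phi_change.
  by apply: reeb_endo_smooth; [exact: img_open|exact: g_smooth|exact: g_sym
    |exact: g_pos|exact: o_sign|exact: o_cont|exact: xi_smooth].
- split=> [i|i j x]; last exact: eta_change.
  by apply: reeb_form_smooth; [exact: img_open|exact: g_smooth|exact: xi_smooth].
- split=> [i x u ix|i x ix|i x u v ix].
  + rewrite -mulmxA.
    have -> : phi i x *m phi i x = eta i x *m xi i x - 1%:M.
      apply: cross_endo_sq.
      * exact: (vol_density_sq (@g_sym i) (@g_pos i) (@o_sign i)).
      * exact: (vol_density_neq0 (@g_sym i) (@g_pos i) (@o_sign i)).
      * exact: g_sym.
      * exact: (xi_metric (@xi1 i)).
    by rewrite mulmxBr mulmx1 mulmxA addrC.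
  + by rewrite mulmxA (xi_metric (@xi1 i) ix) mxE.
  + exact: (reeb_metric_compat _ (@g_sym i) (@g_pos i) (@o_sign i) (@xi1 i)).
- move=> i X Y Xs Ys x ix.
  exact: (reeb_contact (@img_open i) (@g_smooth i) (@g_sym i) (@g_pos i)
    (@o_sign i) (@xi_smooth i) (@nabla_xi i)).
- move=> i; exact: (reeb_integrable (@img_open i) (@g_smooth i) (@g_sym i) (@g_pos i)
    (@o_sign i) (@o_cont i) (@xi_smooth i) (@xi1 i) (@nabla_xi i)).
Qed.

End UnitFieldOnManifold.

Theorem theorem3p1 (R : realType) (M : manifold R 3)
    (g : chart M -> 'rV[R]_3 -> 'M[R]_3) (o : chart M -> 'rV[R]_3 -> R)
    (xi : chart M -> 'rV[R]_3 -> 'rV[R]_3)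
    (B : manifold R 2) (h : chart B -> 'rV[R]_2 -> 'M[R]_2)
    (proj : M -> B) (tau : B -> R) :
  riemannian_metric g ->
  orientation o ->
  simply_connected R M ->
  geodesically_complete g ->
  killing g xi ->
  unit_field g xi ->
  riemannian_metric h ->
  killing_submersion g xi h proj ->
  bundle_curvature g o xi proj tau ->
  (forall b : B, 0 < tau b) ->
  short_magnetic_hopf_surfaces_cmc g o xi proj ->
  exists (phi : chart M -> 'rV[R]_3 -> 'M[R]_3)
         (eta : chart M -> 'rV[R]_3 -> 'cV[R]_3)
         (g' : chart M -> 'rV[R]_3 -> 'M[R]_3),
    sasakian_structure phi eta xi g'.
Proof.
move=> g_metric o_orient _ _ [xi_field _] xi_unit _ _ nabla_xi tau_gt0 _.
exists (fun i => reeb_endo (g i) (o i) (xi i)).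
exists (fun i => reeb_form (g i) (xi i)).
exists (fun i => reeb_metric (g i) (xi i)
  (fun x => tau (proj (chart_inv i x)))).
exact: (sasakian_unit_field (tau := tau \o proj) g_metric o_orient xi_field
  xi_unit (fun p => tau_gt0 (proj p)) nabla_xi).
Qed.
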